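(* Let $\mathcal M,\mathcal N$ be von Neumann algebras, $\mathcal N$ acting on a Hilbert space $\mathcal H$, let $f\in\mathrm{OC}(0,+\infty)$ and $\Phi,\Psi\in\mathrm{CP}(\mathcal M,\mathcal N)$. Then the maximal $f$-divergence $\widehat S_f(\Phi\|\Psi)\in\widehat{\mathbb B(\mathcal H)}_{\mathrm{lb}}$ is affiliated with $\mathcal N$. Consequently, $\widehat S_f(\Phi\|\Psi)\in\widehat{\mathcal N}_{\mathrm{lb}}$.
   Context: Conventions. $\mathrm{CP}(\mathcal M,\mathcal N)$ is the set of all completely positive linear maps $\mathcal M\to\mathcal N$ (not assumed normal). $\mathcal N_*^+$ is the positive cone of the predual. Inner products are linear in the first variable. $\mathrm{OC}(0,+\infty)$ is the set of real-valued operator convex functions on $(0,+\infty)$. We put $0\cdot(+\infty)=0$. Extended lower-semibounded part. For a von Neumann algebra $\mathcal N$, $\widehat{\mathcal N}_{\mathrm{lb}}$ is the set of maps $m:\mathcal N_*^+\to(-\infty,+\infty]$ that are positively homogeneous ($m(\lambda\varphi)=\lambda m(\varphi)$, $\lambda\ge0$), additive, norm lower semicontinuous, and satisfy $m(\varphi)\ge\ell\varphi(1)$ for some $\ell\in\mathbb R$ and all $\varphi$. For $C\in\mathbb B(\mathcal H,\mathcal K)$ and $m\in\widehat{\mathbb B(\mathcal K)}_{\mathrm{lb}}$, $C^*mC\in\widehat{\mathbb B(\mathcal H)}_{\mathrm{lb}}$ is $(C^*mC)(\omega)=m(C\omega C^* )$ with $(C\omega C^* )(X)=\omega(C^*XC)$.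 An element $m\in\widehat{\mathbb B(\mathcal H)}_{\mathrm{lb}}$ is affiliated with $\mathcal N$ if $u'^*mu'=m$ for every unitary $u'\in\mathcal N'$. The map sending $m\in\widehat{\mathcal N}_{\mathrm{lb}}$ to $\omega\mapsto m(\omega|_{\mathcal N})$, $\omega\in\mathbb B(\mathcal H)_*^+$, is a bijection from $\widehat{\mathcal N}_{\mathrm{lb}}$ onto the set of elements of $\widehat{\mathbb B(\mathcal H)}_{\mathrm{lb}}$ affiliated with $\mathcal N$ (a known result, cf. Haagerup), and the two sets are identified through it. Perspective. For $f\in\mathrm{OC}(0,+\infty)$ let $f(+0)=\lim_{t\downarrow0}f(t)$, $f'(+\infty)=\lim_{t\to+\infty}f(t)/t$, and define $\phi_f:[0,\infty)^2\to(-\infty,+\infty]$ by $\phi_f(s,t)=tf(s/t)$ for $s,t>0$, $\phi_f(s,0)=f'(+\infty)s$, $\phi_f(0,t)=f(+0)t$. If $A,B\in\mathbb B(\mathcal K)_+$ with $A+B=I$ and $A=\int_{[0,1]}t\,dE(t)$, then $\phi_f(A,B)\in\widehat{\mathbb B(\mathcal K)}_{\mathrm{lb}}$ is $\phi_f(A,B)(\omega)=\int_{[0,1]}\phi_f(t,1-t)\,d\omega(E(t))$. Divergence. A minimal Stinespring representation $(\pi,V,\mathcal K)$ of $\Gamma\in\mathrm{CP}(\mathcal M,\mathcal N)$ consists of a unital $*$-representation $\pi$ of $\mathcal M$ on $\mathcal K$ and $V\in\mathbb B(\mathcal H,\mathcal K)$ with $\Gamma(x)=V^*\pi(x)V$ and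 $\overline{\operatorname{span}}\,\pi(\mathcal M)V\mathcal H=\mathcal K$. For $\Phi,\Psi\in\mathrm{CP}(\mathcal M,\mathcal N)$, let $(\pi,V,\mathcal K)$ be a minimal Stinespring representation of $\Phi+\Psi$ and $A',B'\in\pi(\mathcal M)'$ the unique positive contractions with $\Phi(x)=V^*A'\pi(x)V$, $\Psi(x)=V^*B'\pi(x)V$ (so $A'+B'=I$). The maximal $f$-divergence is $\widehat S_f(\Phi\|\Psi)=V^*\phi_f(A',B')V\in\widehat{\mathbb B(\mathcal H)}_{\mathrm{lb}}$, independent of the choices. *)

(* Defs.v *)
From HB Require Import structures.
From mathcomp Require Import all_boot all_order all_algebra.
From mathcomp Require Import complex.
From mathcomp Require Import all_classical all_reals all_analysis.

Set Implicit Arguments.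
Unset Strict Implicit.
Unset Printing Implicit Defensive.
Import Order.TTheory GRing.Theory Num.Theory.
Import numFieldNormedType.Exports.

Local Open Scope classical_set_scope.
Local Open Scope ring_scope.
Local Open Scope complex_scope.

(* {dot _ for Num.conj} is linear in the first variable and conjugate-linear
   in the second one.  The norm takes its (real) values in R[i]. *)
HB.mixin Record CompleteNormedModule_isHilbert (R : realType) (H : Type)
    & CompleteNormedModule R[i] H := {
  inner : {dot H for @Num.conj R[i]};
  inner_norm : forall x : H, inner x x = `|x| ^+ 2
}.

#[short(type="hilbertType")]
HB.structure Definition Hilbert (R : realType) :=
  { H of CompleteNormedModule_isHilbert R H & CompleteNormedModule R[i] H }.

Section Operators.
Context (R : realType).
Implicit Types H K L : hilbertType R.

Definition bounded_op H K : set (H -> K) :=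
  [set T | linear T /\ continuous T].

Definition adjoint H K (T : H -> K) : K -> H :=
  xget 0 [set S | forall x y, inner (T x) y = inner x (S y)].

Definition positive_op H (T : H -> H) : Prop :=
  forall x, 0 <= inner (T x) x.

Definition op_le H (S T : H -> H) : Prop := positive_op (T - S).

Definition unitary_op H (T : H -> H) : Prop :=
  [/\ bounded_op T, adjoint T \o T = idfun & T \o adjoint T = idfun].

Definition commutant H (S : set (H -> H)) : set (H -> H) :=
  [set T | bounded_op T /\ forall X, S X -> T \o X = X \o T].

Definition von_neumann_algebra H (N : set (H -> H)) : Prop :=
  (forall X, N X -> N (adjoint X)) /\ commutant (commutant N) = N.

Definition linear_on H (V : lmodType R[i]) (N : set (H -> H))
    (F : (H -> H) -> V) : Prop :=
  forall (a : R[i]) X Y, N X -> N Y -> F (a *: X + Y) = a *: F X + F Y.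

(* Positivity of the matrix (X i j), acting on the direct sum of n copies
   of H. *)
Definition positive_op_mx H n (X : 'I_n -> 'I_n -> H -> H) : Prop :=
  forall xi : 'I_n -> H, 0 <= \sum_i inner (\sum_j X i j (xi j)) (xi i).

(* A map between von Neumann algebras M and N is represented by a function on
   all operators, of which only the values on M are ever used. *)
Definition completely_positive L H (M : set (L -> L)) (N : set (H -> H))
    (Phi : (L -> L) -> H -> H) : Prop :=
  [/\ forall X, M X -> N (Phi X),
      linear_on M Phi
    & forall n (X : 'I_n -> 'I_n -> L -> L), (forall i j, M (X i j)) ->
        positive_op_mx X -> positive_op_mx (fun i j => Phi (X i j))].

End Operators.

(* A functional on N is represented by a function on all operators which
   vanishes outside N; restriction to N is patch (fun=> 0) N. *)
Section Predual.
Context (R : realType).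
Implicit Types H K : hilbertType R.

Definition square_summable H (xi : nat -> H) : Prop :=
  (\sum_(n <oo) (complex.Re (inner (xi n) (xi n)))%:E < +oo)%E.

(* The seminorms |sum_n <X xi_n, eta_n>| defining the sigma-weak topology. *)
Definition sigma_weak_seminorm H (xi eta : nat -> H) (X : H -> H) : R[i] :=
  `|limn (series (fun n => inner (X (xi n)) (eta n) : R[i]^o))|.

Definition sigma_weakly_continuous H (N : set (H -> H))
    (phi : (H -> H) -> R[i]) : Prop :=
  forall X0, N X0 -> forall e : R[i], 0 < e ->
  exists k (xi eta : 'I_k -> nat -> H) (d : R[i]),
    [/\ forall i, square_summable (xi i) /\ square_summable (eta i),
        0 < d
      & forall X, N X ->
          (forall i, sigma_weak_seminorm (xi i) (eta i) (X - X0) < d) ->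
          `|phi X - phi X0| < e].

Definition predual H (N : set (H -> H)) : set ((H -> H) -> R[i]) :=
  [set phi | [/\ forall X, ~ N X -> phi X = 0,
                 forall (a : R[i]) X Y, N X -> N Y ->
                   phi (a *: X + Y) = a * phi X + phi Y
               & sigma_weakly_continuous N phi]].

Definition predual_pos H (N : set (H -> H)) : set ((H -> H) -> R[i]) :=
  [set phi | predual N phi /\
             forall X, N X -> positive_op X -> 0 <= phi X].

Definition functional_norm H (N : set (H -> H)) (phi : (H -> H) -> R[i]) :
    \bar R :=
  ereal_sup [set (complex.Re `|phi X|)%:E | X in
    [set X | N X /\ forall x, `|X x| <= `|x|]].

Definition restriction H (N : set (H -> H)) (omega : (H -> H) -> R[i]) :
    (H -> H) -> R[i] :=
  patch (fun=> 0) N omega.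

(* C omega C^*, a functional on B(K), for C : H -> K and omega on B(H). *)
Definition push H K (C : H -> K) (omega : (H -> H) -> R[i]) :
    (K -> K) -> R[i] :=
  restriction (@bounded_op R K K)
    (fun X : K -> K => omega (adjoint C \o X \o C)).

(* The extended lower-semibounded part of N.  Only the values of m on the
   positive cone of the predual are relevant; two such m are the same element
   when they agree there. *)
Definition ext_lb H (N : set (H -> H))
    (m : ((H -> H) -> R[i]) -> \bar R) : Prop :=
  [/\ forall phi, predual_pos N phi -> m phi <> -oo%E,
      forall (a : R) phi, 0 <= a -> predual_pos N phi ->
        m (fun X => a%:C * phi X) = (a%:E * m phi)%E,
      forall phi psi, predual_pos N phi -> predual_pos N psi ->
        m (phi + psi) = (m phi + m psi)%E,
      (* norm lower semicontinuity *)
      forall phi, predual_pos N phi -> forall r : R, (r%:E < m phi)%E ->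
        exists2 d : R, 0 < d & forall psi, predual_pos N psi ->
          (functional_norm N (psi - phi)%R < d%:E)%E -> (r%:E < m psi)%E
    & exists l : R, forall phi, predual_pos N phi ->
        ((l * complex.Re (phi idfun))%:E <= m phi)%E].

(* C^* m C *)
Definition compress H K (C : H -> K) (m : ((K -> K) -> R[i]) -> \bar R) :
    ((H -> H) -> R[i]) -> \bar R :=
  fun omega => m (push C omega).

Definition affiliated H (N : set (H -> H))
    (m : ((H -> H) -> R[i]) -> \bar R) : Prop :=
  forall u : H -> H, unitary_op u -> commutant N u ->
  forall omega, predual_pos (@bounded_op R H H) omega ->
    compress u m omega = m omega.

(* The element m of the extended part of B(H) belongs to the extended part of
   N, under the identification of the latter with a set of functions on the
   cone of B(H)_* . *)
Definition belongs_to_ext_lb H (N : set (H -> H))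
    (m : ((H -> H) -> R[i]) -> \bar R) : Prop :=
  exists2 m0, ext_lb N m0 &
    forall omega, predual_pos (@bounded_op R H H) omega ->
      m omega = m0 (restriction N omega).

End Predual.

Section OperatorConvex.
Context (R : realType).

(* Hermitian with spectrum in (0, +oo) *)
Definition hermitian_pos_spectrum n (A : 'M[R[i]]_n) : Prop :=
  A \is hermsymmx /\ forall a, eigenvalue A a -> 0 < a.

Definition mx_fun (f : R -> R) n (A : 'M[R[i]]_n) : 'M[R[i]]_n :=
  invmx (spectralmx A) *m
  diag_mx (map_mx (fun z => (f (complex.Re z))%:C) (spectral_diag A)) *m
  spectralmx A.

Definition mx_le n (A B : 'M[R[i]]_n) : Prop :=
  forall v : 'rV[R[i]]_n, 0 <= dotmx (v *m (B - A)) v.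

(* Only the values of f on (0, +oo) matter. *)
Definition operator_convex (f : R -> R) : Prop :=
  forall n (A B : 'M[R[i]]_n) (t : R),
    hermitian_pos_spectrum A -> hermitian_pos_spectrum B -> 0 <= t <= 1 ->
    mx_le (mx_fun f (t%:C *: A + (1 - t)%:C *: B))
          (t%:C *: mx_fun f A + (1 - t)%:C *: mx_fun f B).

Definition limit_at_0 (f : R -> R) : \bar R := lim ((f t)%:E @[t --> 0^'+]).

Definition slope_at_infty (f : R -> R) : \bar R :=
  lim ((f t / t)%:E @[t --> +oo]).

Definition perspective (f : R -> R) (s t : R) : \bar R :=
  if t == 0 then (slope_at_infty f * s%:E)%E
  else if s == 0 then (limit_at_0 f * t%:E)%E
  else (t * f (s / t))%:E.

End OperatorConvex.

Section Perspective.
Context (R : realType).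
Implicit Types K : hilbertType R.

(* E is a projection-valued measure on the Borel sets of R, concentrated on
   [0, 1]. *)
Definition projection_measure K (E : set R -> K -> K) : Prop :=
  [/\ forall S, measurable S ->
        [/\ bounded_op (E S), E S \o E S = E S & adjoint (E S) = E S],
      E `[0, 1]%classic = idfun /\ E setT = idfun,
      forall S T, measurable S -> measurable T -> E (S `&` T) = E S \o E T
    & forall (S : nat -> set R), (forall n, measurable (S n)) ->
        trivIset setT S ->
        forall x, series (fun n => E (S n) x) @ \oo --> E (\bigcup_n S n) x].

Definition scalar_measure K (E : set R -> K -> K)
    (omega : (K -> K) -> R[i]) : set R -> \bar R :=
  fun S => (complex.Re (omega (E S)))%:E.

(* A = \int_[0,1] t dE(t), in the weak sense; by polarization the diagonal
   coefficients suffice. *)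
Definition spectral_measure_of K (A : K -> K) (E : set R -> K -> K) : Prop :=
  projection_measure E /\
  forall x : K,
    inner (A x) x \is Num.real /\
    (complex.Re (inner (A x) x))%:E =
      (\int[scalar_measure E (fun X => inner (X x) x)]_(t in `[0%R, 1%R])
         t%:E)%E.

(* p = phi_f(A, B) on the cone of B(K)_*, for A, B >= 0 with A + B = I. *)
Definition is_op_perspective K (f : R -> R) (A B : K -> K)
    (p : ((K -> K) -> R[i]) -> \bar R) : Prop :=
  [/\ bounded_op A /\ bounded_op B, positive_op A /\ positive_op B,
      A + B = idfun
    & exists2 E, spectral_measure_of A E &
        forall omega, predual_pos (@bounded_op R K K) omega ->
          p omega = (\int[scalar_measure E omega]_(t in `[0%R, 1%R])
                       perspective f t (1 - t)%R)%E].

End Perspective.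

Section Divergence.
Context (R : realType).
Implicit Types H K L : hilbertType R.

Definition unital_star_rep L K (M : set (L -> L)) (pi : (L -> L) -> K -> K) :
    Prop :=
  [/\ forall X, M X -> bounded_op (pi X),
      linear_on M pi,
      forall X Y, M X -> M Y -> pi (X \o Y) = pi X \o pi Y,
      forall X, M X -> pi (adjoint X) = adjoint (pi X)
    & pi idfun = idfun].

Definition minimal_stinespring L H K (M : set (L -> L))
    (Gamma : (L -> L) -> H -> H) (pi : (L -> L) -> K -> K) (V : H -> K) :
    Prop :=
  [/\ unital_star_rep M pi,
      bounded_op V,
      forall X, M X -> Gamma X = adjoint V \o pi X \o V
    & closure [set k | exists n (X : 'I_n -> L -> L) (h : 'I_n -> H),
                 (forall i, M (X i)) /\ k = \sum_i pi (X i) (V (h i))]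
      = setT].

(* S is the maximal f-divergence of Phi and Psi, as a function on the cone of
   B(H)_*, computed from some minimal Stinespring representation. *)
Definition is_maximal_divergence L H (M : set (L -> L)) (f : R -> R)
    (Phi Psi : (L -> L) -> H -> H) (S : ((H -> H) -> R[i]) -> \bar R) : Prop :=
  exists (K : hilbertType R) (pi : (L -> L) -> K -> K) (V : H -> K)
    (A B : K -> K) (p : ((K -> K) -> R[i]) -> \bar R),
  [/\ minimal_stinespring M (Phi + Psi) pi V,
      [/\ commutant (pi @` M) A, positive_op A, op_le A idfun
        & forall X, M X -> Phi X = adjoint V \o A \o pi X \o V],
      [/\ commutant (pi @` M) B, positive_op B, op_le B idfun
        & forall X, M X -> Psi X = adjoint V \o B \o pi X \o V],
      is_op_perspective f A B p
    & forall omega, predual_pos (@bounded_op R H H) omega ->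
        S omega = compress V p omega].

End Divergence.

(* Main.v *)
Require Import Defs.
From HB Require Import structures.
From mathcomp Require Import all_boot all_order all_algebra.
From mathcomp Require Import complex.
From mathcomp Require Import all_classical all_reals all_analysis.
From mathcomp Require Import measurable_realfun.
From mathcomp Require Import ring lra.

(** The divergence is the integral of the perspective function against the
    scalar measures S |-> omega(V^* E(S) V), where V is the operator in the
    Stinespring representation of Phi + Psi, and E is the spectral measure of
    the Radon-Nikodym operator A of Phi, that is Phi(x) = V^* A pi(x) V.  The
    theorem holds because the operators V^* E(S) V belong to N.

    To see this, let X be in the commutant of N.  Since Phi + Psi has its values
    in N, the prescription pi(x) V h |-> pi(x) V X h defines a bounded operator T
    on the Stinespring space, and since Phi has its values in N as well, T
    commutes with A (commutant_lift).  Boundedness is the delicate point; it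
    follows from the log-convexity of the norms of the vectors attached to the
    powers of X^* X.  By Fuglede's theorem (commute_spectral_projection) T
    commutes with E(S), so that X commutes with V^* E(S) V, and the double
    commutant property concludes (compressed_projection_mem).  The proof of
    Fuglede's theorem compares the exponential growth rates of the powers of
    c - A and c + A on spectral subspaces that belong to separated parts of
    the line, and then passes to half-lines and to Borel sets.

    Once S |-> V^* E(S) V is known to be a positive operator valued measure G
    with values in N, the integral of the perspective against phi(G(.)) makes
    sense for every normal positive functional phi on N.  It is lower
    semibounded, additive, positively homogeneous and lower semicontinuous
    (povm_integral_ext_lb), because the perspective is measurable and bounded
    below (measurable_perspective, perspective_bounded_below), and its value at
    the restriction of omega is the divergence at omega, so it is the required
    element of the extended part of N.  Affiliation follows because
    u^* V^* E(S) V u = V^* E(S) V for unitary u in the commutant. *)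

Set Implicit Arguments.
Unset Strict Implicit.
Unset Printing Implicit Defensive.
Import Order.TTheory GRing.Theory Num.Theory.
Import numFieldNormedType.Exports.

Local Open Scope classical_set_scope.
Local Open Scope ring_scope.
Local Open Scope complex_scope.

(** * Complex numbers and the real-valued norm of a Hilbert space *)

Section ComplexNumbers.
Context (R : realType).
Implicit Types z w : R[i].

Lemma Re_EC (a : R) : complex.Re a%:C = a. Proof. by []. Qed.

Lemma ReD z w : complex.Re (z + w) = complex.Re z + complex.Re w.
Proof. by case: z w => [? ?] []. Qed.

Lemma ReN z : complex.Re (- z) = - complex.Re z.
Proof. by case: z. Qed.

Lemma ReB z w : complex.Re (z - w) = complex.Re z - complex.Re w.
Proof. by rewrite ReD ReN. Qed.

Lemma ReZ (a : R) z : complex.Re (a%:C * z) = a * complex.Re z.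
Proof. by case: z => x y /=; ring. Qed.

Lemma Re_sum (I : Type) (r : seq I) (F : I -> R[i]) :
  complex.Re (\sum_(i <- r) F i) = \sum_(i <- r) complex.Re (F i).
Proof. by apply: (big_morph _ ReD). Qed.

Lemma ReJ z : complex.Re (z^*)%R = complex.Re z.
Proof. by case: z. Qed.

Lemma ge0_ReE z : 0 <= z -> z = (complex.Re z)%:C.
Proof. by move=> z0; rewrite RRe_real // ger0_real. Qed.

Lemma Re_norm_ge0 z : 0 <= complex.Re `|z|.
Proof. by have := normr_ge0 z; rewrite lecE => /andP[]. Qed.

Lemma norm_EC z : `|z| = (complex.Re `|z|)%:C.
Proof. exact: ge0_ReE. Qed.

Lemma Re_norm_EC (a : R) : complex.Re `|a%:C| = `|a|.
Proof. by rewrite normc_def /= expr0n addr0 sqrtr_sqr. Qed.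

Lemma Re_le_norm z : `|complex.Re z| <= complex.Re `|z|.
Proof. by have := normc_ge_Re z; rewrite norm_EC lecR. Qed.

Lemma le0_Re z : 0 <= z -> 0 <= complex.Re z.
Proof. by rewrite lecE => /andP[]. Qed.

(** Identities between inner products are proved for their real parts, with one
    vector replaced by its multiple by i as a second test. *)
Lemma eq_Re_rot z w : complex.Re z = complex.Re w ->
  complex.Re ('i * z) = complex.Re ('i * w) -> z = w.
Proof.
case: z w => a b [c d] /= -> h; congr Complex; move: h; lra.
Qed.

Lemma real_gt0_EC (e : R[i]) : 0 < e -> exists2 r : R, 0 < r & e = r%:C.
Proof.
move=> e0; exists (complex.Re e); last by apply: ge0_ReE; exact: ltW.
by move: e0; rewrite ltcE => /andP[].
Qed.

End ComplexNumbers.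

Section HilbertSpace.
Context (R : realType).
Implicit Types H K : hilbertType R.

(** The norm of a Hilbert space takes its values in R[i], whose order is
    partial; estimates are carried out with this real-valued copy. *)
Definition hnorm H (x : H) : R := complex.Re `|x|.

Lemma hnormE H (x : H) : `|x| = (hnorm x)%:C.
Proof. by apply: ge0_ReE. Qed.

Lemma hnorm_ge0 H (x : H) : 0 <= hnorm x.
Proof. exact: (le0_Re (normr_ge0 x)). Qed.

Lemma hnorm0 H : hnorm (0 : H) = 0.
Proof. by rewrite /hnorm normr0. Qed.

Lemma hnorm_eq0 H (x : H) : hnorm x = 0 -> x = 0.
Proof. by move=> x0; apply/normr0_eq0; rewrite hnormE x0. Qed.

Lemma hnorm_opp H (x : H) : hnorm (- x) = hnorm x.
Proof. by rewrite /hnorm normrN. Qed.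

Lemma hnormBC H (x y : H) : hnorm (x - y) = hnorm (y - x).
Proof. by rewrite -hnorm_opp opprB. Qed.

Lemma hnorm_leD H (x y : H) : hnorm (x + y) <= hnorm x + hnorm y.
Proof. by have := ler_normD x y; rewrite !hnormE -rmorphD lecR. Qed.

Lemma hnorm_leB H (x y : H) : hnorm (x - y) <= hnorm x + hnorm y.
Proof. by rewrite -(hnorm_opp y) hnorm_leD. Qed.

Lemma hnorm_scale H a (x : H) : hnorm (a *: x) = complex.Re `|a| * hnorm x.
Proof. by rewrite /hnorm normrZ (norm_EC a) ReZ. Qed.

Lemma hnorm_le_sum H (I : Type) (r : seq I) (F : I -> H) :
  hnorm (\sum_(i <- r) F i) <= \sum_(i <- r) hnorm (F i).
Proof.
apply: (big_ind2 (fun x a => hnorm x <= a)) => [|x a y b xa yb|//].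
  by rewrite hnorm0.
by apply: (le_trans (hnorm_leD x y)); exact: lerD.
Qed.

Lemma innerC H (x y : H) : inner x y = ((inner y x)^*)%R.
Proof. by rewrite hermC /= expr0 mul1r. Qed.

Lemma innerDl H (x y z : H) : inner (x + y) z = inner x z + inner y z.
Proof. by rewrite linearDl. Qed.
Lemma innerBl H (x y z : H) : inner (x - y) z = inner x z - inner y z.
Proof. by rewrite linearBl. Qed.
Lemma innerZl H a (x z : H) : inner (a *: x) z = a * inner x z.
Proof. by rewrite linearZl. Qed.
Lemma inner0l H (z : H) : inner 0 z = 0.
Proof. by rewrite linear0l. Qed.

Lemma innerDr H (x y z : H) : inner z (x + y) = inner z x + inner z y.
Proof. by rewrite linearDr. Qed.
Lemma innerNr H (x z : H) : inner z (- x) = - inner z x.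
Proof. by rewrite linearNr. Qed.
Lemma innerBr H (x y z : H) : inner z (x - y) = inner z x - inner z y.
Proof. by rewrite linearBr. Qed.
Lemma innerZr H a (x z : H) : inner z (a *: x) = (a^*)%R * inner z x.
Proof. by rewrite linearZr. Qed.
Lemma inner0r H (z : H) : inner z 0 = 0.
Proof. by rewrite linear0r. Qed.

Lemma inner_suml H (I : Type) (r : seq I) (F : I -> H) z :
  inner (\sum_(i <- r) F i) z = \sum_(i <- r) inner (F i) z.
Proof.
by apply: (big_morph (fun x => inner x z)) => [x y|];
  rewrite (innerDl, inner0l).
Qed.

Lemma inner_sumr H (I : Type) (r : seq I) (F : I -> H) z :
  inner z (\sum_(i <- r) F i) = \sum_(i <- r) inner z (F i).
Proof. by apply: big_morph => [x y|]; rewrite (innerDr, inner0r). Qed.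

Lemma innerxx H (x : H) : inner x x = (hnorm x ^+ 2)%:C.
Proof. by rewrite inner_norm hnormE rmorphXn. Qed.

Lemma Re_innerC H (x y : H) :
  complex.Re (inner x y) = complex.Re (inner y x).
Proof. by rewrite innerC ReJ. Qed.

Lemma inner_ext H (x y : H) : (forall z, inner x z = inner y z) -> x = y.
Proof.
move=> xy; apply/eqP; rewrite -subr_eq0; apply/eqP/hnorm_eq0.
apply/eqP; rewrite -sqrf_eq0; apply/eqP/(@complexI R).
by rewrite -innerxx innerBl xy subrr.
Qed.

Lemma inner_extr H (x y : H) : (forall z, inner z x = inner z y) -> x = y.
Proof. by move=> xy; apply: inner_ext => z; rewrite innerC xy -innerC. Qed.

Lemma hnormD_sq H (x y : H) : hnorm (x + y) ^+ 2 =
  hnorm x ^+ 2 + 2 * complex.Re (inner x y) + hnorm y ^+ 2.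
Proof.
have /(congr1 (@complex.Re R)) := innerxx (x + y).
rewrite innerDl !innerDr !ReD (Re_innerC y x) !innerxx !Re_EC => <-; ring.
Qed.

Lemma hnormB_sq H (x y : H) : hnorm (x - y) ^+ 2 =
  hnorm x ^+ 2 - 2 * complex.Re (inner x y) + hnorm y ^+ 2.
Proof. by rewrite hnormD_sq hnorm_opp innerNr ReN mulrN. Qed.

Lemma Re_inner_le H (x y : H) :
  complex.Re (inner x y) <= hnorm x * hnorm y.
Proof.
have [y0|y0] := eqVneq (hnorm y) 0.
  by rewrite (hnorm_eq0 y0) inner0r hnorm0 mulr0.
have [x0|x0] := eqVneq (hnorm x) 0.
  by rewrite (hnorm_eq0 x0) inner0l hnorm0 mul0r.
have xp : 0 < hnorm x by rewrite lt_def x0 hnorm_ge0.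
have yp : 0 < hnorm y by rewrite lt_def y0 hnorm_ge0.
have := sqr_ge0 (hnorm ((hnorm y)%:C *: x - (hnorm x)%:C *: y)).
rewrite hnormB_sq !hnorm_scale innerZl ReZ innerC ReJ innerZl ReZ Re_innerC.
rewrite !Re_norm_EC !ger0_norm ?hnorm_ge0 // => h.
rewrite -(ler_pM2l (mulr_gt0 xp yp)); move: h; nra.
Qed.

(** Cauchy-Schwarz: rotate x by the phase of the inner product, so that its
    modulus becomes a real part. *)
Lemma norm_inner_le H (x y : H) :
  complex.Re `|inner x y| <= hnorm x * hnorm y.
Proof.
set a := inner x y.
have [a0|a0] := eqVneq a 0.
  by rewrite a0 normr0 mulr_ge0 // hnorm_ge0.
have n0 : `|a| != 0 by rewrite normr_eq0.
have := Re_inner_le (((a^*)%R / `|a|) *: x) y.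
have u : `|(a^*)%R / `|a| | = 1.
  by rewrite normrM normfV norm_conjC normr_id divff.
rewrite hnorm_scale u mul1r innerZl -/a.
suff -> : (a^*)%R / `|a| * a = `|a| by [].
by rewrite mulrAC -normCKC expr2 mulfK.
Qed.

Lemma parallelogram H (x y : H) :
  hnorm (x + y) ^+ 2 + hnorm (x - y) ^+ 2 =
  2 * hnorm x ^+ 2 + 2 * hnorm y ^+ 2.
Proof. by rewrite hnormD_sq hnormB_sq; ring. Qed.

Lemma hcvgP H (u : nat -> H) (l : H) : (u @ \oo --> l) <->
  (forall e : R, 0 < e ->
     exists N, forall n, (N <= n)%N -> hnorm (u n - l) < e).
Proof.
split=> [/cvgrPdist_lt ul e e0|ul].
  have /ul[N _ hN] : 0 < e%:C by rewrite ltcR.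
  by exists N => n /hN; rewrite hnormE ltcR hnormBC.
apply/cvgrPdist_lt => e /real_gt0_EC[r r0 ->].
have [N hN] := ul r r0; exists N => // n /hN.
by rewrite hnormE ltcR hnormBC.
Qed.

Lemma hcauchy_cvg H (u : nat -> H) :
  (forall e : R, 0 < e -> exists N, forall m n, (N <= m)%N -> (N <= n)%N ->
     hnorm (u m - u n) < e) ->
  exists l : H, u @ \oo --> l.
Proof.
move=> uc; apply/cvg_ex; apply/cauchy_cvgP/cauchy_ballP => e.
move=> /real_gt0_EC[r r0 ->].
have [N hN] := uc r r0.
exists (u @` [set n | (N <= n)%N], u @` [set n | (N <= n)%N]).
  by split; exists N => // n Nn; exists n.
move=> [_ _] [/= [m Nm <-] [n Nn <-]].
by rewrite -ball_normE /ball_ /= hnormE ltcR; exact: hN.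
Qed.

Lemma eq_of_hnorm_lt H (x y : H) :
  (forall e : R, 0 < e -> hnorm (x - y) < e) -> x = y.
Proof.
move=> h; apply/eqP; rewrite -subr_eq0; apply/eqP/hnorm_eq0/eqP.
rewrite eq_le hnorm_ge0 andbT; apply/ler_addgt0Pr => e e0.
by rewrite add0r ltW // h.
Qed.

End HilbertSpace.

(** * Riesz representation, adjoints and von Neumann algebras *)

Section Operators.
Context (R : realType).
Implicit Types H K L : hilbertType R.

Lemma linear_funD H K (T : H -> K) : linear T ->
  forall x y, T (x + y) = T x + T y.
Proof. by move=> lT x y; have := lT 1 x y; rewrite !scale1r. Qed.

Lemma linear_fun0 H K (T : H -> K) : linear T -> T 0 = 0.
Proof. by move=> lT; have := lT (-1) 0 0; rewrite scaler0 add0r scaleN1r addNr. Qed.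

Lemma linear_funZ H K (T : H -> K) : linear T ->
  forall a x, T (a *: x) = a *: T x.
Proof. by move=> lT a x; have := lT a x 0; rewrite (linear_fun0 lT) !addr0. Qed.

Lemma linear_funN H K (T : H -> K) : linear T -> forall x, T (- x) = - T x.
Proof. by move=> lT x; rewrite -scaleN1r (linear_funZ lT) scaleN1r. Qed.

Lemma linear_funB H K (T : H -> K) : linear T ->
  forall x y, T (x - y) = T x - T y.
Proof. by move=> lT x y; rewrite (linear_funD lT) (linear_funN lT). Qed.

Lemma linear_fun_sum H K (T : H -> K) (I : Type) (r : seq I) (F : I -> H) :
  linear T -> T (\sum_(i <- r) F i) = \sum_(i <- r) T (F i).
Proof.
by move=> lT; apply: big_morph => [x y|]; [exact: linear_funD|exact: linear_fun0].
Qed.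

Lemma bounded_opP H K (T : H -> K) : bounded_op T <->
  linear T /\ exists2 c : R, 0 < c & forall x, hnorm (T x) <= c * hnorm x.
Proof.
split=> [[lT cT]|[lT [c c0 Tc]]]; split=> //.
  pose f := GRing.isLinear.Build _ _ _ _ T lT.
  pose g : {linear H -> K} := HB.pack T f.
  have /linear_boundedP/pinfty_ex_gt0[M /real_gt0_EC[r r0 ->] hM] :
    bounded_near g (nbhs (0 : H)) by apply: continuous_linear_bounded; exact: cT.
  by exists r => // x; have := hM x; rewrite /= !hnormE -rmorphM lecR.
move=> x; apply/cvgrPdist_lt => e /real_gt0_EC[r r0 ->].
near=> y; rewrite hnormE ltcR -(linear_funB lT).
apply: (le_lt_trans (Tc _)); rewrite -ltr_pdivlMl // -ltcR -hnormE.
near: y; apply: cvgr_dist_lt => //.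
by rewrite ltcR mulr_gt0 // invr_gt0.
Unshelve. all: by end_near. Qed.

(** The functional J(x) = |x|^2 - 2 Re g(x) is bounded below because g is
    bounded, and the parallelogram identity makes every minimizing sequence
    Cauchy.  Its limit y satisfies the Euler equation of J, which says that
    g is the inner product with y. *)
Lemma riesz_representation H (g : H -> R[i]) (c : R) :
  (forall a x y, g (a *: x + y) = a * g x + g y) ->
  (forall x, complex.Re `|g x| <= c * hnorm x) ->
  exists y, forall x, g x = inner x y.
Proof.
move=> lg gc.
have g0 : g 0 = 0.
  by have := lg (-1) 0 0; rewrite scaler0 add0r mulN1r addNr.
have gD x y : g (x + y) = g x + g y.
  by have := lg 1 x y; rewrite scale1r mul1r.
have gZ a x : g (a *: x) = a * g x.
  by have := lg a x 0; rewrite g0 !addr0.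
pose J x := hnorm x ^+ 2 - 2 * complex.Re (g x).
have Jlb x : - c ^+ 2 <= J x.
  have := le_trans (Re_le_norm (g x)) (gc x).
  have := ler_norm (complex.Re (g x)).
  have := sqr_ge0 (hnorm x - c); rewrite /J; lra.
have infJ : has_inf (range J).
  split; first by exists (J 0), 0.
  by exists (- c ^+ 2) => _ [x _ <-].
pose I := inf (range J).
have Ile x : I <= J x by apply: ge_inf; [exact: infJ.2|exists x].
have /choice[u uI] : forall n : nat, exists x, J x < I + n.+1%:R^-1.
  move=> n; have n0 : 0 < n.+1%:R^-1 :> R by rewrite invr_gt0.
  by have [_ [x _ <-] ?] := inf_adherent n0 infJ; exists x.
have par x y : hnorm (x - y) ^+ 2 <= 2 * (J x - I) + 2 * (J y - I).
  have := Ile ((2^-1)%:C *: (x + y)).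
  have := parallelogram x y.
  rewrite /J hnorm_scale gZ gD ReZ ReD ger0_norm ?ler0c ?invr_ge0 ?ler0n // Re_EC.
  rewrite exprMn; lra.
have smalln (e : R) : 0 < e -> exists N, forall n, (N <= n)%N -> n.+1%:R^-1 < e.
  move=> e0; have [N _ hN] := near_infty_natSinv_lt (PosNum e0).
  by exists N => n; exact: hN.
have [l ul] : exists l : H, u @ \oo --> l.
  apply: hcauchy_cvg => e e0.
  have [N hN] := smalln (e ^+ 2 / 4) (divr_gt0 (exprn_gt0 2 e0) (ltr0n _ 4)).
  exists N => m n Nm Nn.
  rewrite -(@ltr_pXn2r _ 2) ?nnegrE ?hnorm_ge0 // ?ltW //.
  apply: (le_lt_trans (par _ _)).
  have Jm : J (u m) < I + e ^+ 2 / 4.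
    by apply: (lt_trans (uI m)); rewrite ltrD2l hN.
  have Jn : J (u n) < I + e ^+ 2 / 4.
    by apply: (lt_trans (uI n)); rewrite ltrD2l hN.
  move: Jm Jn; lra.
have ReE z : complex.Re (inner l z) = complex.Re (g z).
  set D := complex.Re (inner l z) - complex.Re (g z).
  suff D0 : D ^+ 2 <= 0.
    by apply/subr0_eq/eqP; rewrite -/D -sqrf_eq0 eq_le D0 sqr_ge0.
  set w := hnorm z ^+ 2.
  have w0 : 0 <= w by exact: sqr_ge0.
  suff key (e : R) : 0 < e -> e <= 1 -> D ^+ 2 <= 4 * e * w.
    apply/ler_addgt0Pr => e e0; rewrite add0r.
    have w1 : 0 < w + 1 by lra.
    pose e' := Num.min 1 (e / (4 * (w + 1))).
    have e'0 : 0 < e' by rewrite lt_min ltr01 divr_gt0 // mulr_gt0.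
    apply: (le_trans (key e' e'0 _)); first by rewrite ge_min lexx.
    have : e' <= e / (4 * (w + 1)) by rewrite ge_min lexx orbT.
    rewrite ler_pdivlMr ?mulr_gt0 //; move: e'0; nra.
  move=> e0 e1.
  have [N1 hN1] := smalln e e0; have [N2 hN2] := (hcvgP u l).1 ul e e0.
  pose n := maxn N1 N2; have n1 := hN1 n (leq_maxl _ _).
  have n2 := hN2 n (leq_maxr _ _).
  set d := complex.Re (inner (u n) z) - complex.Re (g z).
  have dw : d ^+ 2 <= e * w.
    (* J (u n) is within e of the infimum, hence the first variation d of J
       at u n in the direction z is at most sqrt e |z|. *)
    have var t : - e <= t ^+ 2 * w + 2 * t * d.
      have := Ile (u n + t%:C *: z); have := uI n.
      rewrite /J hnormD_sq gD gZ hnorm_scale exprMn ReD ReZ innerC ReJ innerZl ReZ.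
      rewrite Re_innerC -/w Re_norm_EC real_normK ?num_real // => ub lb.
      have := hN1 n (leq_maxl _ _); move: ub lb; rewrite /J /d.
      move: (n.+1%:R^-1) => q; lra.
    have [w00|w00] := eqVneq w 0.
      have z0 : z = 0 by apply/hnorm_eq0/eqP; rewrite -sqrf_eq0 -/w w00.
      by rewrite /d z0 inner0r g0 subrr expr0n w00 mulr0.
    have wp : 0 < w by rewrite lt_def w00.
    have := var (- d / w).
    have -> : (- d / w) ^+ 2 * w + 2 * (- d / w) * d = - (d ^+ 2 / w).
      by field.
    by rewrite lerN2 ler_pdivrMr.
  have := norm_inner_le (l - u n) z; set v := inner _ _ => vle.
  have vr : `|complex.Re v| <= complex.Re `|v| := Re_le_norm v.
  have vw : complex.Re v ^+ 2 <= e * w.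
    have n2' : hnorm (l - u n) ^+ 2 <= e.
      rewrite hnormBC; have := hnorm_ge0 (u n - l); move: n2; nra.
    apply: (@le_trans _ _ ((hnorm (l - u n) * hnorm z) ^+ 2)).
      rewrite -(real_normK (num_real (complex.Re v))).
      by rewrite ler_pXn2r ?nnegrE ?mulr_ge0 ?hnorm_ge0 // (le_trans vr).
    by rewrite exprMn ler_wpM2r.
  have -> : D = d + complex.Re v.
    by rewrite /D /d /v innerBl ReB; ring.
  have := sqr_ge0 (d - complex.Re v); move: dw vw; nra.
exists l => x; apply: eq_Re_rot; first by rewrite -ReE Re_innerC.
by rewrite -gZ -ReE Re_innerC innerZl.
Qed.

(** The adjoint is a choice of a formal adjoint, if there is one; existence is
    the Riesz theorem applied to x |-> <T x, y>. *)
Lemma adjointP H K (T : H -> K) : bounded_op T ->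
  forall x y, inner (T x) y = inner x (adjoint T y).
Proof.
move=> /bounded_opP[lT [c c0 Tc]].
suff /choice[S hS] : forall y, exists z, forall x, inner (T x) y = inner x z.
  have := @xgetPex _ 0 [set S | forall x y, inner (T x) y = inner x (S y)].
  by apply; exists S => x y; exact: hS.
move=> y; apply: (riesz_representation (c := c * hnorm y)).
  by move=> a x x'; rewrite lT innerDl innerZl.
move=> x; apply: (le_trans (norm_inner_le _ _)).
by rewrite mulrAC ler_wpM2r ?hnorm_ge0.
Qed.

Lemma adjointPr H K (T : H -> K) : bounded_op T ->
  forall x y, inner (adjoint T y) x = inner y (T x).
Proof. by move=> bT x y; rewrite innerC -adjointP // -innerC. Qed.

Lemma adjoint_uniq H K (T : H -> K) (S : K -> H) :
  (forall x y, inner (T x) y = inner x (S y)) -> adjoint T = S.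
Proof.
move=> TS; have := @xgetPex _ 0 [set S | forall x y, inner (T x) y = inner x (S y)].
move=> /(_ (ex_intro _ S TS)) /= h; apply/funext => y; apply: inner_extr => x.
by rewrite -TS -h.
Qed.

Lemma adjoint_bounded H K (T : H -> K) : bounded_op T -> bounded_op (adjoint T).
Proof.
move=> bT; have [lT [c c0 Tc]] := (bounded_opP T).1 bT.
apply/bounded_opP; split=> [a x y|].
  apply: inner_extr => z.
  by rewrite innerDr innerZr -!adjointP // innerDr innerZr.
exists c => // y; have [->|n0] := eqVneq (hnorm (adjoint T y)) 0.
  by rewrite mulr_ge0 ?hnorm_ge0 // ltW.
have np : 0 < hnorm (adjoint T y) by rewrite lt_def n0 hnorm_ge0.
rewrite -(ler_pM2r np) -expr2 -[leLHS]Re_EC -innerxx -adjointP //.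
apply: (le_trans (Re_inner_le _ _)).
by rewrite [leRHS]mulrAC ler_wpM2r ?hnorm_ge0.
Qed.

Lemma adjointK H K (T : H -> K) : bounded_op T -> adjoint (adjoint T) = T.
Proof. by move=> bT; apply: adjoint_uniq => x y; exact: adjointPr. Qed.

Lemma bounded_op_id H : bounded_op (idfun : H -> H).
Proof.
by apply/bounded_opP; split => //; exists 1 => // x; rewrite mul1r.
Qed.

Lemma bounded_op_comp H K L (S : K -> L) (T : H -> K) :
  bounded_op S -> bounded_op T -> bounded_op (S \o T).
Proof.
move=> /bounded_opP[lS [c c0 Sc]] /bounded_opP[lT [d d0 Td]].
apply/bounded_opP; split=> [a x y /=|]; first by rewrite lT lS.
exists (c * d) => [|x /=]; first exact: mulr_gt0.
by apply: (le_trans (Sc _)); rewrite -mulrA ler_pM2l.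
Qed.

Lemma bounded_op_linear H K a (S T : H -> K) :
  bounded_op S -> bounded_op T -> bounded_op (a *: S + T).
Proof.
move=> /bounded_opP[lS [c c0 Sc]] /bounded_opP[lT [d d0 Td]].
apply/bounded_opP; split=> [b x y|].
  rewrite !fctE lS lT; rewrite !scalerDr !scalerA [b * a]mulrC.
  by rewrite addrACA.
exists (complex.Re `|a| * c + d) => [|x].
  by rewrite ltr_wpDl // mulr_ge0 ?Re_norm_ge0 // ltW.
have -> : (a *: S + T) x = a *: S x + T x by [].
rewrite mulrDl; apply: (le_trans (hnorm_leD _ _)).
apply: lerD => //.
by rewrite hnorm_scale -mulrA ler_wpM2l // Re_norm_ge0.
Qed.

Lemma adjoint_comp H K L (S : K -> L) (T : H -> K) :
  bounded_op S -> bounded_op T -> adjoint (S \o T) = adjoint T \o adjoint S.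
Proof. by move=> bS bT; apply: adjoint_uniq => x y /=; rewrite !adjointP. Qed.

Lemma commutant_adjoint H (N : set (H -> H)) (X : H -> H) :
  (forall Y, N Y -> bounded_op Y) -> (forall Y, N Y -> N (adjoint Y)) ->
  commutant N X -> commutant N (adjoint X).
Proof.
move=> bN aN [bX cX]; split; first exact: adjoint_bounded.
move=> Y NY; have bY := bN _ NY.
rewrite -{1}(adjointK bY) -adjoint_comp //; last exact/adjoint_bounded.
rewrite -cX; last exact: aN.
by rewrite adjoint_comp ?adjointK //; apply: adjoint_bounded.
Qed.

Section VonNeumannAlgebra.
Context H (N : set (H -> H)) (vN : von_neumann_algebra N).

Lemma vN_commutant2 X : N X <-> commutant (commutant N) X.
Proof. by rewrite vN.2. Qed.

Lemma vN_bounded X : N X -> bounded_op X.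
Proof. by rewrite vN_commutant2 => -[]. Qed.

Lemma vN_id : N idfun.
Proof. by apply/vN_commutant2; split; first exact: bounded_op_id. Qed.

Lemma vN_comp X Y : N X -> N Y -> N (X \o Y).
Proof.
move=> /vN_commutant2[bX cX] /vN_commutant2[bY cY].
apply/vN_commutant2; split=> [|Z CZ]; first exact: bounded_op_comp.
by rewrite -compA cY // compA cX // compA.
Qed.

Lemma vN_linear a X Y : N X -> N Y -> N (a *: X + Y).
Proof.
move=> /vN_commutant2[bX cX] /vN_commutant2[bY cY].
apply/vN_commutant2; split=> [|Z CZ]; first exact: bounded_op_linear.
have [lZ _] := CZ.1.
apply/funext => x; have /(congr1 (@^~ x)) /= := cX Z CZ.
have /(congr1 (@^~ x)) /= := cY Z CZ; rewrite !fctE.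
by rewrite (linear_funD lZ) (linear_funZ lZ) => <- <-.
Qed.

Lemma vN_add X Y : N X -> N Y -> N (X + Y).
Proof. by move=> NX NY; rewrite -[X]scale1r; exact: vN_linear. Qed.

Lemma vN_scale a X : N X -> N (a *: X).
Proof.
move=> NX; have -> : a *: X = (a - 1) *: X + X.
  by rewrite scalerBl scale1r subrK.
exact: vN_linear.
Qed.

Lemma vN_opp X : N X -> N (- X).
Proof. by rewrite -scaleN1r; exact: vN_scale. Qed.

Lemma vN_sub X Y : N X -> N Y -> N (X - Y).
Proof. by move=> NX /vN_opp; exact: vN_add. Qed.

Lemma vN_commutant_adjoint X : commutant N X -> commutant N (adjoint X).
Proof. by apply: commutant_adjoint; [exact: vN_bounded|exact: vN.1]. Qed.

End VonNeumannAlgebra.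

(** Results on a general von Neumann algebra thereby apply to B(H) as well. *)
Lemma von_neumann_bounded_op H : von_neumann_algebra (@bounded_op R H H).
Proof.
split; first by move=> X; exact: adjoint_bounded.
apply/seteqP; split=> X; first by case.
by move=> bX; split=> // Y [bY cY]; rewrite cY.
Qed.

(** Polarization: the values at x + y and x + i y of a form that is real on the
    diagonal determine <B x, y> as the conjugate of <B y, x>. *)
Lemma positive_op_selfadjoint H (B : H -> H) : linear B -> positive_op B ->
  forall x y, inner (B x) y = inner x (B y).
Proof.
move=> lB pB x y.
have BD := linear_funD lB; have BZ := linear_funZ lB.
have Im0 z : complex.Im (inner (B z) z) = 0 by apply: ger0_Im; exact: pB.
rewrite [RHS]innerC.
have h1 := Im0 (x + y); have h2 := Im0 (x + 'i *: y).
move: h1 h2; rewrite !BD BZ !innerDl !innerDr !innerZl !innerZr.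
have := Im0 x; have := Im0 y.
move: (inner (B x) x) (inner (B y) y) (inner (B x) y) (inner (B y) x).
by case=> ? ? [? ?] [? ?] [? ?] /=; move=> ? ? h1 h2;
  congr Complex; move: h1 h2; lra.
Qed.

End Operators.

(** * Extension of densely defined bounded operators *)

Section DenseExtension.
Context (R : realType).
Implicit Types H K : hilbertType R.

Lemma dense_inner_ext K (F : Type) (k : F -> K) :
  (forall x (e : R), 0 < e -> exists s, hnorm (x - k s) < e) ->
  forall x y, (forall s, inner (k s) x = inner (k s) y) -> x = y.
Proof.
move=> dk x y xy; apply: eq_of_hnorm_lt => e e0.
have [s hs] := dk (x - y) e e0.
have orth : inner (k s) (x - y) = 0 by rewrite innerBr xy subrr.
apply: le_lt_trans hs; rewrite -(@ler_pXn2r _ 2) ?nnegrE ?hnorm_ge0 //.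
by rewrite [leRHS]hnormB_sq Re_innerC orth /= mulr0 subr0 lerDl sqr_ge0.
Qed.

Lemma eq_on_dense H K (F : Type) (k : F -> H) (S T : H -> K) :
  (forall x (e : R), 0 < e -> exists s, hnorm (x - k s) < e) ->
  bounded_op S -> bounded_op T ->
  (forall s, S (k s) = T (k s)) -> S = T.
Proof.
move=> dk bS bT ST; have [aS aT] := (adjoint_bounded bS, adjoint_bounded bT).
suff : adjoint S = adjoint T by move=> /(congr1 (@adjoint _ _ _)); rewrite !adjointK.
apply/funext => y; apply: (dense_inner_ext dk) => s.
by rewrite -!adjointP // ST.
Qed.

(** The map to be extended is given by its graph, k0 s |-> k1 s, because a
    vector may have several presentations k0 s; that it is well defined is part
    of the norm bound. *)
Lemma dense_extension H K (F : Type) (k0 : F -> H) (k1 : F -> K) (c : R) :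
  0 < c ->
  (forall x (e : R), 0 < e -> exists s, hnorm (x - k0 s) < e) ->
  (forall a s t, exists u, k0 u = a *: k0 s + k0 t /\ k1 u = a *: k1 s + k1 t) ->
  (forall s, hnorm (k1 s) <= c * hnorm (k0 s)) ->
  exists2 T : H -> K, bounded_op T & forall s, T (k0 s) = k1 s.
Proof.
move=> c0 dk lk bk.
have subk s t : hnorm (k1 s - k1 t) <= c * hnorm (k0 s - k0 t).
  have [u [u0 u1]] := lk (-1) t s.
  by have := bk u; rewrite u0 u1 !scaleN1r ![- _ + _]addrC.
have approx x : exists y, forall e : R, 0 < e ->
    exists s, hnorm (x - k0 s) < e /\ hnorm (y - k1 s) < e.
  have inv0 n : 0 < n.+1%:R^-1 :> R by rewrite invr_gt0.
  have /choice[s hs] n := dk x n.+1%:R^-1 (inv0 n).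
  have small (e : R) : 0 < e -> exists N, forall n, (N <= n)%N ->
      hnorm (x - k0 (s n)) < e.
    move=> e0; have [N _ hN] := near_infty_natSinv_lt (PosNum e0).
    by exists N => n /hN; exact: lt_trans (hs n).
  have [y hy] : exists y : K, (k1 \o s) @ \oo --> y.
    apply: hcauchy_cvg => e e0.
    have e'0 : 0 < e / (2 * c) by rewrite divr_gt0 // mulr_gt0.
    have [N hN] := small _ e'0; exists N => m n Nm Nn /=.
    apply: (le_lt_trans (subk _ _)).
    have -> : k0 (s m) - k0 (s n) = (x - k0 (s n)) - (x - k0 (s m)).
      by rewrite opprB [RHS]addrC subrKA.
    have := hnorm_leB (x - k0 (s n)) (x - k0 (s m)).
    have := hN m Nm; have := hN n Nn; rewrite !ltr_pdivlMr ?mulr_gt0 //.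
    move: c0; nra.
  exists y => e e0; have [N1 h1] := small e e0.
  have [N2 h2] := (hcvgP (k1 \o s) y).1 hy e e0.
  exists (s (maxn N1 N2)); split; first exact/h1/leq_maxl.
  by rewrite hnormBC; exact/h2/leq_maxr.
have [T hT] := choice approx.
have Tk x s : hnorm (T x - k1 s) <= c * hnorm (x - k0 s).
  apply/ler_addgt0Pr => e e0.
  have d0 : 0 < e / (1 + c) by rewrite divr_gt0 // addr_gt0.
  have [t [t0 t1]] := hT x _ d0.
  have := hnorm_leD (T x - k1 t) (k1 t - k1 s); rewrite subrKA.
  have := subk t s; have := hnorm_leD (k0 t - x) (x - k0 s).
  rewrite subrKA; rewrite hnormBC in t0.
  move: t0 t1; rewrite !ltr_pdivlMr ?addr_gt0 // => t0 t1 h1 h2 h3.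
  move: (hnorm_ge0 (k0 t - x)) (hnorm_ge0 (T x - k1 t)); nra.
(* The estimate Tk contains both the extension property and linearity. *)
exists T => [|s]; last first.
  apply: eq_of_hnorm_lt => e e0; apply: le_lt_trans e0.
  by rewrite (le_trans (Tk _ _)) // subrr hnorm0 mulr0.
apply/bounded_opP; split=> [a x y|].
  apply: eq_of_hnorm_lt => e e0.
  set A := complex.Re `|a|; have A0 : 0 <= A by exact: Re_norm_ge0.
  pose B := 2 * c * (A + 1) + 1.
  have B0 : 0 < B by rewrite /B; nra.
  have d0 : 0 < e / B by rewrite divr_gt0.
  have [s hs] := dk x _ d0; have [t ht] := dk y _ d0.
  have [u [u0 u1]] := lk a s t.
  have -> : T (a *: x + y) - (a *: T x + T y) = (T (a *: x + y) - k1 u)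
      - (a *: (T x - k1 s) + (T y - k1 t)).
    rewrite u1 scalerBr.
    set p := T (a *: x + y); set q := a *: T x; set r := a *: k1 s.
    by rewrite addrACA -opprD [in RHS]opprB addrA subrK.
  have h1 := Tk (a *: x + y) u; have h2 := Tk x s; have h3 := Tk y t.
  have h4 : hnorm (a *: x + y - k0 u) <= A * hnorm (x - k0 s) + hnorm (y - k0 t).
    rewrite u0 opprD addrACA -scalerBr (le_trans (hnorm_leD _ _)) //.
    by rewrite hnorm_scale.
  have h5 := hnorm_leD (a *: (T x - k1 s)) (T y - k1 t).
  rewrite hnorm_scale -/A in h5.
  apply: (le_lt_trans (hnorm_leB _ _)).
  apply: (@le_lt_trans _ _
    (2 * c * (A * hnorm (x - k0 s) + hnorm (y - k0 t)))).
    have := ler_wpM2l A0 h2; have := ler_wpM2l (ltW c0) h4.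
    move: h1 h3 h5; rewrite !mulrDr; lra.
  have -> : e = B * (e / B) by rewrite mulrC divfK // gt_eqF.
  move: (e / B) d0 hs ht => d d0 hs ht.
  apply: (@le_lt_trans _ _ (2 * c * (A * d + d))).
    by rewrite ler_pM2l ?mulr_gt0 // lerD ?ler_wpM2l // ltW.
  rewrite /B; lra.
exists c => // x; apply/ler_addgt0Pr => e e0.
have d0 : 0 < e / (2 * c) by rewrite divr_gt0 // mulr_gt0.
have [s hs] := dk x _ d0.
have := hnorm_leD (T x - k1 s) (k1 s); rewrite subrK.
have := Tk x s; have := bk s.
have := hnorm_leB x (x - k0 s); rewrite opprB addrC subrK.
move: hs; rewrite ltr_pdivlMr ?mulr_gt0 //; move: c0; nra.
Qed.

End DenseExtension.

(** * Lifting the commutant of N to the Stinespring space *)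

(** The successive ratios of a log-convex sequence increase, so each of them is
    bounded by the exponential growth rate of the sequence. *)
Lemma log_convex_ratio (R : realType) (a : nat -> R) (M c : R) : 0 < c ->
  (forall n, 0 <= a n) -> (forall n, a n <= M * c ^+ n) ->
  (forall n, a n.+1 ^+ 2 <= a n * a n.+2) -> a 1%N <= c * a 0%N.
Proof.
move=> c0 a0 aM lc; rewrite leNgt; apply/negP => h.
have a0p : 0 < a 0%N.
  rewrite lt_def a0 andbT; apply/eqP => z.
  have := lc 0%N; rewrite z mul0r; move: h; rewrite z mulr0; nra.
have [e e0 he] : exists2 e, 0 < e & c * (1 + e) * a 0%N <= a 1%N.
  exists (a 1%N / (c * a 0%N) - 1).
    by rewrite subr_gt0 ltr_pdivlMr ?mul1r // mulr_gt0.
  by rewrite addrC subrK mulrAC mulrC divfK // gt_eqF // mulr_gt0.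
have r0 : 0 < c * (1 + e) by nra.
have step n : 0 < a n /\ c * (1 + e) * a n <= a n.+1.
  elim: n => [//|n [an0 ih]].
  have an1 : 0 < a n.+1 by apply: lt_le_trans ih; exact: mulr_gt0.
  split=> //; rewrite -(ler_pM2l an0); apply: le_trans (lc n).
  by rewrite mulrCA mulrA expr2 ler_pM2r // mulrC.
have grow n : (c * (1 + e)) ^+ n * a 0%N <= a n.
  elim: n => [|n ih]; first by rewrite expr0 mul1r.
  by rewrite exprS -mulrA; apply: le_trans (step n).2; rewrite ler_pM2l.
have bern n : 1 + n%:R * e <= (1 + e) ^+ n.
  elim: n => [|n ih]; first by rewrite mul0r addr0.
  rewrite exprS -natr1; have : 0 <= n%:R :> R by []; move: ih e0; nra.
have bd n : (1 + n%:R * e) * a 0%N <= M.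
  have cn : 0 < c ^+ n by exact: exprn_gt0.
  rewrite -(ler_pM2r cn); apply: le_trans (aM n); apply: le_trans (grow n).
  have -> : (c * (1 + e)) ^+ n * a 0%N = (1 + e) ^+ n * a 0%N * c ^+ n.
    by rewrite exprMn; ring.
  by rewrite ler_pM2r // ler_pM2r.
pose n := Num.bound (M / (e * a 0%N)).
have M0 : 0 <= M by apply: le_trans (bd 0%N); rewrite mul0r addr0 mul1r ltW.
have : M / (e * a 0%N) < n%:R.
  by apply: archi_boundP; rewrite divr_ge0 // mulr_ge0 // ltW.
rewrite ltr_pdivrMr ?mulr_gt0 //; have := bd n; nra.
Qed.

Section Intertwiner.
Context (R : realType) (L H K : hilbertType R).
Context (M : set (L -> L)) (N : set (H -> H)).
Context (pi : (L -> L) -> K -> K) (V : H -> K).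
Hypotheses (vM : von_neumann_algebra M) (vN : von_neumann_algebra N).
Hypotheses (rep : unital_star_rep M pi) (bV : bounded_op V).

(* For X in N', the vectors vec X s and vec idfun s are the value and the
   argument of the lift of X to K; the family s presents the argument. *)
Let family := seq ({x : L -> L | M x} * H).
Let vec (X : H -> H) (s : family) : K :=
  \sum_(p <- s) pi (sval p.1) (V (X p.2)).

Let pi_bounded (p : {x : L -> L | M x}) : bounded_op (pi (sval p)).
Proof. by case: rep => h *; apply: h; exact: svalP. Qed.

Let lV := bV.1.

Lemma vec_linear X a s t : linear X -> exists u,
  vec idfun u = a *: vec idfun s + vec idfun t /\
  vec X u = a *: vec X s + vec X t.
Proof.
move=> lX; exists ([seq (p.1, a *: p.2) | p <- s] ++ t).
suff E Y : linear Y ->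
    vec Y ([seq (p.1, a *: p.2) | p <- s] ++ t) = a *: vec Y s + vec Y t.
  by split; apply: E.
move=> lY; rewrite /vec big_cat big_map scaler_sumr; congr +%R.
apply: eq_bigr => p _ /=.
by rewrite (linear_funZ lY) (linear_funZ lV) (linear_funZ (pi_bounded p.1).1).
Qed.

Lemma vec_dense : closure [set k | exists n (X : 'I_n -> L -> L) (h : 'I_n -> H),
    (forall i, M (X i)) /\ k = \sum_i pi (X i) (V (h i))] = setT ->
  forall x (e : R), 0 < e -> exists s, hnorm (x - vec idfun s) < e.
Proof.
move=> cl x e e0.
have /(_ (ball x e%:C))[|k [[n [X [h [MX ->]]]]]] :
    closure [set k | exists n (X : 'I_n -> L -> L) (h : 'I_n -> H),
    (forall i, M (X i)) /\ k = \sum_i pi (X i) (V (h i))] x by rewrite cl.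
  by apply: nbhsx_ballx; rewrite ltcR.
rewrite -ball_normE /ball_ /= hnormE ltcR => xe.
exists [seq (exist _ (X i) (MX i), h i) | i <- enum 'I_n].
by rewrite /vec big_map big_enum.
Qed.

(** Each matrix coefficient of W between pi(x) V X h and pi(y) V g is the
    coefficient of V^* W pi(y^* x) V, an element of N, between X h and g; there
    X commutes past it. *)
Lemma vec_intertwine (W : K -> K) (X : H -> H) :
  commutant (pi @` M) W -> commutant N X ->
  (forall x, M x -> N (adjoint V \o W \o pi x \o V)) ->
  forall s t, inner (W (vec X s)) (vec idfun t) =
              inner (W (vec idfun s)) (vec (adjoint X) t).
Proof.
move=> [bW cW] [bX cX] NG s t; case: (rep) => _ _ piM piA _.
rewrite /vec !(linear_fun_sum _ _ bW.1) !inner_suml.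
apply: eq_bigr => -[[x Mx] h] _ /=.
rewrite !inner_sumr; apply: eq_bigr => -[[y My] g] _ /=.
have My' : M (adjoint y) := vM.1 _ My.
have by_ : bounded_op (pi y) by exact: (pi_bounded (exist _ y My)).
have NG' := NG _ (vN_comp vM My' Mx).
pose G := adjoint V \o W \o pi (adjoint y \o x) \o V.
have E h' g' : inner (W (pi x (V h'))) (pi y (V g')) = inner (G h') g'.
  rewrite /G /= adjointPr // piM //=.
  have /(congr1 (@^~ (pi x (V h')))) /= -> :=
    cW (pi (adjoint y)) (ex_intro2 _ _ _ My' erefl).
  by rewrite piA // adjointPr.
rewrite !E -adjointP //.
by have /(congr1 (@^~ h)) /= -> := cX _ NG'.
Qed.


Lemma vec_comp X Y s : vec (X \o Y) s = vec X [seq (p.1, Y p.2) | p <- s].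
Proof. by rewrite /vec big_map. Qed.

Hypothesis NG : forall x, M x -> N (adjoint V \o pi x \o V).

Lemma vec_adjoint X Y Z s t : commutant N X ->
  inner (vec (X \o Y) s) (vec Z t) = inner (vec Y s) (vec (adjoint X \o Z) t).
Proof.
move=> cX.
have cid : commutant (pi @` M) idfun by split=> //; exact: bounded_op_id.
have := vec_intertwine cid cX NG [seq (p.1, Y p.2) | p <- s]
  [seq (p.1, Z p.2) | p <- t].
by rewrite -!vec_comp /=.
Qed.

(** For self-adjoint C the norms of vec (C^n) s form a log-convex sequence which
    grows at most like c^n, whence the bound on the first ratio. *)
Lemma vec_bounded_selfadjoint C c s : commutant N C -> adjoint C = C ->
  0 < c -> (forall h, hnorm (C h) <= c * hnorm h) ->
  hnorm (vec C s) <= c * hnorm (vec idfun s).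
Proof.
move=> cC aC c0 Cc; pose Cn n := iter n (fun Y => C \o Y) (idfun : H -> H).
have Cnc n h : hnorm (Cn n h) <= c ^+ n * hnorm h.
  elim: n => [|n ih]; first by rewrite expr0 mul1r.
  by rewrite exprS -mulrA; apply: (le_trans (Cc _)); rewrite ler_pM2l.
have [d d0 Vd] := ((bounded_opP V).1 bV).2.
have /choice[b hb] : forall p : {x : L -> L | M x}, exists r : R,
    0 < r /\ forall x, hnorm (pi (sval p) x) <= r * hnorm x.
  by move=> p; have [_ [r r0 hr]] := (bounded_opP _).1 (pi_bounded p); exists r.
apply: (@log_convex_ratio _ (fun n => hnorm (vec (Cn n) s))
  (\sum_(p <- s) b p.1 * d * hnorm p.2)) => // n; first exact: hnorm_ge0.
  rewrite /vec mulr_suml; apply: (le_trans (hnorm_le_sum _ _)).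
  apply: ler_sum => p _; apply: (le_trans ((hb p.1).2 _)).
  rewrite -!mulrA ler_pM2l ?(hb p.1).1 //; apply: (le_trans (Vd _)).
  by rewrite ler_pM2l // mulrC.
rewrite -[leLHS]Re_EC -innerxx.
by rewrite [Cn n.+1]/(C \o Cn n) vec_adjoint // aC Re_inner_le.
Qed.

(** |vec X s|^2 = <vec idfun s, vec (X^* X) s>, and X^* X is self-adjoint. *)
Lemma vec_bounded X : commutant N X -> exists2 c : R, 0 < c &
  forall s, hnorm (vec X s) <= c * hnorm (vec idfun s).
Proof.
move=> cX; have caX := vN_commutant_adjoint vN cX.
have bX := cX.1; have baX := caX.1.
pose C := adjoint X \o X.
have bC : bounded_op C by exact: bounded_op_comp.
have cC : commutant N C.
  split=> // Y NY; rewrite /C -compA (cX.2 _ NY) compA (caX.2 _ NY) //.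
have aC : adjoint C = C by rewrite adjoint_comp // adjointK.
have [_ [c c0 Cc]] := (bounded_opP _).1 bC.
exists (c + 1) => [|s]; first by rewrite addr_gt0.
have hC := vec_bounded_selfadjoint s cC aC c0 Cc.
have XX : hnorm (vec X s) ^+ 2 <= c * hnorm (vec idfun s) ^+ 2.
  rewrite -[leLHS]Re_EC -innerxx -{1}[X]/(X \o idfun) vec_adjoint //.
  apply: (le_trans (Re_inner_le _ _)); rewrite mulrC expr2 mulrA.
  by rewrite ler_wpM2r ?hnorm_ge0.
have c1 : 0 <= c + 1 by rewrite addr_ge0 // ltW.
rewrite -(@ler_pXn2r _ 2) ?nnegrE ?mulr_ge0 ?hnorm_ge0 //.
apply: (le_trans XX); rewrite exprMn ler_wpM2r ?sqr_ge0 //.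
by move: c0; nra.
Qed.

Hypothesis cl : closure [set k | exists n (X : 'I_n -> L -> L) (h : 'I_n -> H),
  (forall i, M (X i)) /\ k = \sum_i pi (X i) (V (h i))] = setT.

(** The commutant of N acts on the Stinespring space by pi(x) V h |-> pi(x) V X h.
    The same computation of matrix coefficients shows that this action commutes
    with the Radon-Nikodym operators A, since the associated maps
    x |-> V^* A pi(x) V also take their values in N. *)
Lemma commutant_lift X : commutant N X -> exists T : K -> K,
  [/\ bounded_op T, T \o V = V \o X, adjoint V \o T = X \o adjoint V &
    forall A, commutant (pi @` M) A ->
      (forall x, M x -> N (adjoint V \o A \o pi x \o V)) -> T \o A = A \o T].
Proof.
move=> cX; have caX := vN_commutant_adjoint vN cX.
have dense := vec_dense cl.
have [c c0 Xc] := vec_bounded cX.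
have [T bT TE] := dense_extension c0 dense
  (fun a s t => vec_linear a s t cX.1.1) Xc.
have aTE t : adjoint T (vec idfun t) = vec (adjoint X) t.
  apply: (dense_inner_ext dense) => s.
  by rewrite -adjointP // TE -{1}[X]/(X \o idfun) vec_adjoint.
have VE Y h : V (Y h) = vec Y [:: (exist _ idfun (vN_id vM), h)].
  by rewrite /vec big_seq1 /=; case: rep => _ _ _ _ ->.
have TV : T \o V = V \o X.
  by apply/funext => h /=; rewrite (VE idfun) TE -VE.
exists T; split=> // [|A cA NA].
  apply/funext => u /=; apply: inner_ext => h.
  by rewrite adjointPr // adjointP // (VE idfun) aTE -VE
     [RHS](adjointP cX.1) adjointPr.
apply: (eq_on_dense dense); [exact: bounded_op_comp bT cA.1|
  exact: bounded_op_comp cA.1 bT|move=> s /=].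
apply: (dense_inner_ext dense) => t; rewrite innerC [RHS]innerC; congr (_^*)%R.
by rewrite adjointP // aTE TE -vec_intertwine.
Qed.

End Intertwiner.

(** * Measures from additive real set functions *)

Section MeasureOfAdditive.
Context (R : realType).
Implicit Types nu : set R -> R.
Import HBNNSimple.

(** A scalar measure built from an operator measure has arbitrary values on the
    sets that are not measurable; the integral does not see them. *)
Lemma eq_integral_measurable (mu nu : set R -> \bar R) D (f : R -> \bar R) :
  (forall S, measurable S -> mu S = nu S) ->
  integral mu D f = integral nu D f.
Proof.
move=> mn; suff E (h : {nnsfun R >-> R}) : sintegral mu h = sintegral nu h.
  rewrite /integral; congr (_ - _)%E; congr ereal_sup; apply/seteqP; split;
    by move=> _ [h hf <-]; exists h.
by apply: eq_fsbigr => x _; rewrite mn.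
Qed.

Lemma measure_of_additive nu : nu set0 = 0 ->
  (forall S, measurable S -> 0 <= nu S) ->
  (forall S : nat -> set R, (forall n, measurable (S n)) -> trivIset setT S ->
     series (nu \o S) @ \oo --> nu (\bigcup_n S n)) ->
  exists mu : {measure set R -> \bar R},
    forall S, measurable S -> mu S = (nu S)%:E.
Proof.
move=> nu0 nu_ge0 nuU.
(* A measure has to be nonnegative on all sets, hence the cut-off. *)
pose m S := if `[< measurable S >] then (nu S)%:E else 0%E.
have mE S : measurable S -> m S = (nu S)%:E.
  by move=> mS; rewrite /m asboolT.
have m0 : m set0 = 0%E by rewrite mE // nu0.
have m_ge0 S : (0 <= m S)%E.
  by rewrite /m; case: asboolP => // mS; rewrite lee_fin nu_ge0.
have mU : semi_sigma_additive m.
  move=> F mF tF mUF; rewrite mE //.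
  have -> : (fun n => \sum_(0 <= i < n) m (F i))%E = EFin \o series (nu \o F).
    apply/funext => n /=; rewrite /series /= -sumEFin.
    by apply: eq_bigr => i _; rewrite mE.
  by apply: cvg_EFin; [exact: nearW|exact: nuU].
pose a := isMeasure.Build _ _ _ m m0 m_ge0 mU.
pose mu : {measure set R -> \bar R} := HB.pack m a.
by exists mu.
Qed.

End MeasureOfAdditive.

(** * Projection-valued measures and their spectral integrals *)

Section ProjectionMeasure.
Context (R : realType) (K : hilbertType R) (E : set R -> K -> K).
Hypothesis pE : projection_measure E.

Lemma pm_bounded S : measurable S -> bounded_op (E S).
Proof. by case: pE => h _ _ _ mS; case: (h S mS). Qed.

Lemma pm_linear S : measurable S -> linear (E S).
Proof. by move=> mS; have [] := pm_bounded mS. Qed.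

Lemma pm_idem S x : measurable S -> E S (E S x) = E S x.
Proof.
by case: pE => h _ _ _ mS; case: (h S mS) => _ /(congr1 (@^~ x)) /= -> _.
Qed.

Lemma pm_selfadjoint S x y : measurable S -> inner (E S x) y = inner x (E S y).
Proof.
move=> mS; rewrite adjointP; last exact: pm_bounded.
by case: pE => h _ _ _; case: (h S mS) => _ _ ->.
Qed.

Lemma pm_setI S T x : measurable S -> measurable T ->
  E (S `&` T) x = E S (E T x).
Proof. by case: pE => _ _ h _ mS mT; rewrite h. Qed.

Lemma pm_setT x : E setT x = x.
Proof. by case: pE => _ [_ ->]. Qed.

Lemma pm_unit_interval x : E `[0, 1]%classic x = x.
Proof. by case: pE => _ [-> _]. Qed.

(** The constant series of terms E(0) x converges, so its terms vanish. *)
Lemma pm_set0 x : E set0 x = 0.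
Proof.
case: pE => _ _ _ /(_ (fun=> set0) (fun=> measurable0)) h.
have /h/(_ x) c : trivIset setT (fun _ : nat => set0 : set R).
  by apply/trivIsetP => *; rewrite set0I.
have /cvg_series_cvg_0 : cvgn (series (fun _ : nat => E set0 x)).
  by apply/cvg_ex; eexists; exact: c.
move=> /hcvgP h0; apply: eq_of_hnorm_lt => e /h0[n /(_ n (leqnn n))].
by [].
Qed.

Lemma pm_hnorm_sq S x : measurable S ->
  hnorm (E S x) ^+ 2 = complex.Re (inner (E S x) x).
Proof.
by move=> mS; rewrite -[LHS]Re_EC -innerxx pm_selfadjoint // pm_idem //
  Re_innerC.
Qed.

Lemma pm_contraction S x : measurable S -> hnorm (E S x) <= hnorm x.
Proof.
move=> mS; have := pm_hnorm_sq x mS;  have := Re_inner_le (E S x) x.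
move: (hnorm_ge0 (E S x)) (hnorm_ge0 x); nra.
Qed.

Lemma pm_sigma_additive (S : nat -> set R) : (forall n, measurable (S n)) ->
  trivIset setT S ->
  forall x, series (fun n => E (S n) x) @ \oo --> E (\bigcup_n S n) x.
Proof. by case: pE => _ _ _ h mS tS; exact: h. Qed.

Lemma pm_vector_measure x : exists mu : {measure set R -> \bar R},
  forall S, measurable S -> mu S = (hnorm (E S x) ^+ 2)%:E.
Proof.
apply: measure_of_additive => [|S mS|S mS tS].
- by rewrite pm_set0 hnorm0 expr0n.
- exact: sqr_ge0.
have mU : measurable (\bigcup_n S n) by exact: bigcup_measurable.
have /hcvgP h := @pm_sigma_additive S mS tS x.
apply/cvgrPdist_lt => e e0.
have d0 : 0 < e / (hnorm x + 1) by rewrite divr_gt0 // ltr_wpDl ?hnorm_ge0.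
have [N hN] := h _ d0; exists N => // n /hN {}hN /=.
have -> : series ((fun T => hnorm (E T x) ^+ 2) \o S) n =
    complex.Re (inner (series (fun n => E (S n) x) n) x).
  rewrite /series /= inner_suml Re_sum; apply: eq_bigr => k _.
  exact: pm_hnorm_sq.
rewrite pm_hnorm_sq // -ReB -innerBl.
apply: (le_lt_trans (Re_le_norm _)); apply: (le_lt_trans (norm_inner_le _ _)).
rewrite hnormBC; move: hN; rewrite ltr_pdivlMr ?ltr_wpDl ?hnorm_ge0 //.
apply: le_lt_trans; rewrite ler_wpM2l ?hnorm_ge0 // lerDl //.
Qed.

(** The vectors E(S) x and E(~ S) x are orthogonal and their squared norms add
    up to the one of x, by additivity of the scalar measure; hence they sum up
    to x. *)
Lemma pm_setC S x : measurable S -> E (~` S) x = x - E S x.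
Proof.
move=> mS; have mC : measurable (~` S) by exact: measurableC.
have SC y : E S (E (~` S) y) = 0 by rewrite -pm_setI // setICr pm_set0.
have CS y : E (~` S) (E S y) = 0 by rewrite -pm_setI // setICl pm_set0.
have [mu muE] := pm_vector_measure x.
have sumE : hnorm (E S x) ^+ 2 + hnorm (E (~` S) x) ^+ 2 = hnorm x ^+ 2.
  have : mu setT = (mu S + mu (~` S))%E.
    by rewrite -measureU ?setUv ?setICr.
  by rewrite !muE // pm_setT -EFinD => -[].
apply/eqP; rewrite eq_sym -subr_eq0; apply/eqP/hnorm_eq0/eqP.
rewrite -sqrf_eq0 -[X in X == _]Re_EC -innerxx.
set y := x - E S x - E (~` S) x.
have Sy : E S y = 0.
  by rewrite /y !(linear_funB (pm_linear mS)) pm_idem // SC subr0 subrr.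
have Cy : E (~` S) y = 0.
  by rewrite /y !(linear_funB (pm_linear mC)) pm_idem // CS subr0 subrr.
rewrite {2}/y !innerBr -!pm_selfadjoint // Sy Cy !inner0l !subr0.
rewrite /y !innerBl !ReB -!pm_hnorm_sq // innerxx /=.
by rewrite -sumE; apply/eqP; ring.
Qed.

Section SpectralMeasure.
Context (A : K -> K).
Hypotheses (bA : bounded_op A) (pA : positive_op A)
  (sA : spectral_measure_of A E).
Let D := `[0%R, 1%R]%classic : set R.
Let mD : measurable D.
Proof. exact: measurable_itv. Qed.
Lemma spectral_integral x (mu : {measure set R -> \bar R}) :
  (forall S, measurable S -> mu S = (hnorm (E S x) ^+ 2)%:E) ->
  (complex.Re (inner (A x) x))%:E = (\int[mu]_(t in D) t%:E)%E.
Proof.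
move=> muE; rewrite (sA.2 x).2; apply: eq_integral_measurable => S mS.
by rewrite muE // pm_hnorm_sq.
Qed.

Lemma spectral_concentrated S x (mu : {measure set R -> \bar R}) :
  measurable S -> E S x = x ->
  (forall S, measurable S -> mu S = (hnorm (E S x) ^+ 2)%:E) ->
  (complex.Re (inner (A x) x))%:E = (\int[mu]_(t in D `&` S) t%:E)%E /\
  mu (D `&` S) = (hnorm x ^+ 2)%:E.
Proof.
move=> mS Sx muE.
have mDS : measurable (D `&` S) by exact: measurableI.
have mDC : measurable (D `&` ~` S) by apply: measurableI => //; exact: measurableC.
split; last by rewrite muE // pm_setI // Sx pm_unit_interval.
have mC : measurable (~` S) by exact: measurableC.
rewrite (spectral_integral muE) -{1}(setUIDK D S) setDE.
have D0 t : D t -> (0 <= t%:E)%E by rewrite /D /= in_itv /= lee_fin => /andP[].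
rewrite ge0_integral_setU //; last 2 first.
- by move=> t [] [/D0].
- by rewrite disj_set2E; apply/eqP; rewrite setIACA setICr setI0.
rewrite [X in (_ + X)%E]null_set_integral ?adde0 //.
rewrite muE // pm_setI // pm_setC // Sx subrr (linear_fun0 (pm_linear mD)).
by rewrite hnorm0 expr0n.
Qed.

Lemma spectral_le S a x : measurable S -> E S x = x ->
  (forall t, D t -> S t -> t <= a) ->
  complex.Re (inner (A x) x) <= a * hnorm x ^+ 2.
Proof.
move=> mS Sx Sa; have [mu muE] := pm_vector_measure x.
have [AE muS] := spectral_concentrated mS Sx muE.
have mDS : measurable (D `&` S) by exact: measurableI.
rewrite -lee_fin AE EFinM -muS -integral_cst //.
have [DS0|/set0P[t0 [Dt0 St0]]] := eqVneq (D `&` S) set0.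
  by rewrite DS0 !integral_set0.
have t0a := Sa t0 Dt0 St0.
have D0 t : D t -> (0 <= t)%R by rewrite /D /= in_itv /= => /andP[].
apply: ge0_le_integral => //.
- by move=> t [/D0].
- by move=> t [Dt St]; rewrite lee_fin Sa.
Qed.

Lemma spectral_ge S a x : measurable S -> E S x = x ->
  (forall t, D t -> S t -> a <= t) ->
  a * hnorm x ^+ 2 <= complex.Re (inner (A x) x).
Proof.
move=> mS Sx Sa; have [mu muE] := pm_vector_measure x.
have [AE muS] := spectral_concentrated mS Sx muE.
have mDS : measurable (D `&` S) by exact: measurableI.
have [a0|a0] := leP a 0.
  by apply: (@le_trans _ _ 0); [rewrite mulr_le0_ge0 ?sqr_ge0|exact/le0_Re/pA].
rewrite -lee_fin AE EFinM -muS -integral_cst //.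
apply: ge0_le_integral => //.
- by move=> t _; rewrite lee_fin ltW.
- by move=> t [Dt St]; rewrite lee_fin Sa.
Qed.

Let sa := positive_op_selfadjoint bA.1 pA.

(** The scalar measures of x and y are carried by complementary sets, so the one
    of x + y is their sum.  Hence the quadratic form of A is additive on x and
    y, and its cross term vanishes. *)
Lemma spectral_orthogonal S x y : measurable S -> E S x = x ->
  E (~` S) y = y -> inner (A x) y = 0.
Proof.
move=> mS Sx; have mC : measurable (~` S) by exact: measurableC.
suff re y' : E (~` S) y' = y' -> complex.Re (inner (A x) y') = 0.
  move=> Cy; apply: eq_Re_rot; first by rewrite re.
  rewrite mulr0 -[RHS](re (- 'i *: y)).
    by rewrite innerZr; congr (complex.Re (_ * _)); rewrite rmorphN /= conjCi opprK.
  by rewrite (linear_funZ (pm_linear mC)) Cy.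
move=> {y} Cy; have [mux muxE] := pm_vector_measure x.
have [muy muyE] := pm_vector_measure y'.
pose mu : {measure set R -> \bar R} := measure_add mux muy.
have muE T : measurable T -> mu T = (hnorm (E T (x + y')) ^+ 2)%:E.
  move=> mT; have -> : mu T = (mux T + muy T)%E by exact: measure_addE.
  rewrite muxE // muyE // -EFinD.
  rewrite (linear_funD (pm_linear mT)) hnormD_sq.
  suff -> : inner (E T x) (E T y') = 0 by rewrite mulr0 addr0.
  have -> : E T x = E S (E T x) by rewrite -pm_setI // setIC pm_setI // Sx.
  rewrite pm_selfadjoint // -Cy -[E T (E _ _)]pm_setI // -pm_setI //.
    by rewrite setICA setICr setI0 pm_set0 inner0r.
  exact: measurableI.
have : ((complex.Re (inner (A (x + y')) (x + y')))%:E =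
   (complex.Re (inner (A x) x))%:E + (complex.Re (inner (A y') y'))%:E)%E.
  rewrite (spectral_integral muE) (spectral_integral muxE) (spectral_integral muyE).
  rewrite ge0_integral_measure_add //.
  - by move=> t; rewrite /D /= in_itv /= lee_fin => /andP[].
rewrite -EFinD => -[]; rewrite (linear_funD bA.1) !innerDl !innerDr !ReD.
by rewrite (sa y' x) (Re_innerC y'); lra.
Qed.

Lemma spectral_commute S x : measurable S -> A (E S x) = E S (A x).
Proof.
move=> mS; have mC : measurable (~` S) by exact: measurableC.
have h y : E (~` S) (A (E S y)) = 0.
  apply: inner_ext => z; rewrite inner0l pm_selfadjoint //.
  by apply: (spectral_orthogonal mS); rewrite pm_idem.
have h' y : E S (A (E (~` S) y)) = 0.
  apply: inner_ext => z; rewrite inner0l pm_selfadjoint // sa innerC.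
  by rewrite (spectral_orthogonal mS) ?conjC0 ?pm_idem.
have := h x; rewrite pm_setC // => /subr0_eq ->.
have := h' x; rewrite pm_setC // (linear_funB bA.1) (linear_funB (pm_linear mS)).
by move=> /subr0_eq.
Qed.

End SpectralMeasure.
End ProjectionMeasure.

(** * Commutation with spectral projections *)

Section GrowthSeparation.
Context (R : realType) (K : hilbertType R).

(** B acts with norm at most q on the range of Q and expands by at least p > q
    on the range of P.  Thus B^m T Q x = T B^m Q x grows at most like q^m,
    while its P-component grows at least like p^m; the component is zero. *)
Lemma growth_separation (B P Q T : K -> K) (p q : R) :
  bounded_op B -> positive_op B -> bounded_op T ->
  (forall x, hnorm (P x) <= hnorm x) ->
  (forall x, B (P x) = P (B x)) -> (forall x, B (Q x) = Q (B x)) ->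
  (forall x, T (B x) = B (T x)) ->
  (forall x, p * hnorm (P x) ^+ 2 <= complex.Re (inner (B (P x)) (P x))) ->
  (forall x, complex.Re (inner (B (Q x)) (Q x)) <= q * hnorm (Q x) ^+ 2) ->
  0 < q -> q < p -> forall x, P (T (Q x)) = 0.
Proof.
move=> bB pB /bounded_opP[lT [c c0 Tc]] Pc BP BQ TB Pp Qq q0 qp x.
have sB := positive_op_selfadjoint bB.1 pB.
have p0 : 0 < p by exact: lt_trans qp.
(* Positivity of B at Q z - q^-1 B Q z gives |B Q z| <= q |Q z|. *)
have upper z : hnorm (B (Q z)) <= q * hnorm (Q z).
  have q_ge0 := ltW q0.
  rewrite -(@ler_pXn2r _ 2) ?nnegrE ?mulr_ge0 ?hnorm_ge0 // exprMn.
  have := le0_Re (pB (Q z - (q^-1)%:C *: B (Q z))).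
  rewrite (linear_funB bB.1) (linear_funZ bB.1) !innerBl !innerBr !innerZl.
  rewrite [inner (B (Q z)) (_ *: _)]innerC [inner (B (B (Q z))) (_ *: _)]innerC.
  rewrite !innerZl !ReB !ReZ !ReJ !ReZ (sB (B (Q z))) innerxx Re_EC.
  rewrite [complex.Re (inner (B (Q z)) (B (B _)))]Re_innerC BQ.
  have := Qq z; have := Qq (B z); rewrite -BQ.
  move: (complex.Re (inner (B (B (Q z))) (B (Q z)))) => g.
  move: (complex.Re (inner (B (Q z)) (Q z))) (hnorm (B (Q z)) ^+ 2) => a b.
  move: (hnorm (Q z) ^+ 2) => n gb an.
  have qi : 0 < q^-1 by rewrite invr_gt0.
  have : q^-1 * (q^-1 * g) <= q^-1 * b.
    by rewrite ler_pM2l // ler_pdivrMl.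
  move=> h1 h2; have : q^-1 * b <= q * n by lra.
  by rewrite ler_pdivrMl // expr2 mulrA.
have lower z : p * hnorm (P z) <= hnorm (B (P z)).
  have [z0|z0] := eqVneq (hnorm (P z)) 0; first by rewrite z0 mulr0 hnorm_ge0.
  have zp : 0 < hnorm (P z) by rewrite lt_def z0 hnorm_ge0.
  rewrite -(ler_pM2r zp) -mulrA -expr2.
  exact: le_trans (Pp z) (Re_inner_le _ _).
have iterQ m z : iter m B (Q z) = Q (iter m B z).
  by elim: m => //= m ->; rewrite BQ.
have iterP m z : iter m B (P z) = P (iter m B z).
  by elim: m => //= m ->; rewrite BP.
have iterT m z : iter m B (T z) = T (iter m B z).
  by elim: m => //= m ->; rewrite TB.
have upm m : hnorm (iter m B (Q x)) <= q ^+ m * hnorm (Q x).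
  elim: m => [|m ih]; first by rewrite mul1r.
  rewrite iterS iterQ exprS -mulrA; apply: (le_trans (upper _)).
  by rewrite -iterQ ler_pM2l.
have lom m z : p ^+ m * hnorm (P z) <= hnorm (iter m B (P z)).
  elim: m => [|m ih]; first by rewrite mul1r.
  rewrite iterS iterP exprS -mulrA; apply: le_trans (lower _).
  by rewrite -iterP ler_pM2l.
apply/hnorm_eq0/eqP; rewrite eq_le hnorm_ge0 andbT.
set a := hnorm _.
have a0 : 0 <= a by exact: hnorm_ge0.
have : p ^+ 1 * a <= q * (p ^+ 0 * a).
  apply: (@log_convex_ratio _ (fun n => p ^+ n * a) (c * hnorm (Q x)) q) => // n.
  - by rewrite mulr_ge0 // exprn_ge0 // ltW.
  - apply: (le_trans (lom n _)); rewrite iterP iterT.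
    apply: (le_trans (Pc _)); apply: (le_trans (Tc _)).
    by rewrite -mulrA ler_pM2l // mulrC.
  - rewrite le_eqVlt; apply/orP; left; apply/eqP; rewrite !exprS; ring.
by rewrite expr1 expr0 mul1r; move: qp a0; nra.
Qed.

End GrowthSeparation.

Section Fuglede.
Context (R : realType) (K : hilbertType R) (E : set R -> K -> K) (A T : K -> K).
Hypotheses (pE : projection_measure E) (sA : spectral_measure_of A E).
Hypotheses (bA : bounded_op A) (pA : positive_op A).
Hypotheses (bT : bounded_op T) (TA : forall x, T (A x) = A (T x)).

Let D0 (t : R) : `[0%R, 1%R]%classic t -> 0 <= t <= 1.
Proof. by rewrite /= in_itv. Qed.

Let normA x : complex.Re (inner (A x) x) <= hnorm x ^+ 2.
Proof.
rewrite -[leRHS]mul1r; apply: (spectral_le pE sA measurableT).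
  exact: pm_setT.
by move=> t /D0/andP[].
Qed.

(* The sign s decides which of two separated spectral sets has the faster
   growth; the shift c makes the operator positive. *)
Let affine (c s : R) (x : K) : K := c%:C *: x + s%:C *: A x.

Let affine_bounded c s : bounded_op (affine c s).
Proof.
rewrite (_ : affine c s = c%:C *: idfun + s%:C *: A) //.
have vB := von_neumann_bounded_op K.
by apply: (vN_linear vB); [exact: bounded_op_id|exact: (vN_scale vB)].
Qed.

Let affine_form c s x : inner (affine c s x) x =
  (c * hnorm x ^+ 2 + s * complex.Re (inner (A x) x))%:C.
Proof.
by rewrite innerDl !innerZl innerxx [inner (A x) x]ge0_ReE // rmorphD !rmorphM.
Qed.

Let affine_commute c s S x : measurable S -> affine c s (E S x) = E S (affine c s x).
Proof.
move=> mS; rewrite /affine (linear_funD (pm_linear pE mS)).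
by rewrite !(linear_funZ (pm_linear pE mS)) (spectral_commute pE bA pA sA).
Qed.

Let T_affine c s x : T (affine c s x) = affine c s (T x).
Proof. by rewrite /affine (linear_funD bT.1) !(linear_funZ bT.1) TA. Qed.

(** Apply the growth argument to c - A, and to c + A for the other order. *)
Lemma commutant_separated (a b : R) (S S' : set R) x :
  a < b -> measurable S -> measurable S' ->
  (forall t, S t -> t <= a) -> (forall t, S' t -> b <= t) ->
  E S (T (E S' x)) = 0 /\ E S' (T (E S x)) = 0.
Proof.
move=> ab mS mS' Sa Sb.
(* with this c, both c - A and c + A are positive, and all four rates c - b,
   c - a, c + a and c + b are positive *)
pose c := 1 + `|a| + `|b|.
have ca : `|a| < c by rewrite /c -addrA addrCA ltrDl ltr_pwDl.
have cb : `|b| < c by rewrite /c ltrDr ltr_pwDl.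
have [ca1 ca2] : - c < a /\ a < c by move: ca; rewrite ltr_norml => /andP[].
have [cb1 cb2] : - c < b /\ b < c by move: cb; rewrite ltr_norml => /andP[].
have c1 : 1 <= c by rewrite /c -addrA lerDl addr_ge0.
have Epos s : s = 1 \/ s = -1 -> positive_op (affine c s).
  move=> hs x'; rewrite affine_form ler0c.
  have := normA x'; have := le0_Re (pA x'); have := sqr_ge0 (hnorm x').
  by case: hs => ->; nra.
have le1 y : complex.Re (inner (A (E S y)) (E S y)) <= a * hnorm (E S y) ^+ 2.
  by apply: (spectral_le pE sA mS) => [|t _ /Sa]; first exact: pm_idem.
have ge1 y : b * hnorm (E S' y) ^+ 2 <= complex.Re (inner (A (E S' y)) (E S' y)).
  by apply: (spectral_ge pE pA sA mS') => [|t _ /Sb]; first exact: pm_idem.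
split.
  apply: (@growth_separation _ _ (affine c (-1)) (E S) (E S') T (c - a) (c - b)) => //.
  - by apply: Epos; right.
  - by move=> y; exact: pm_contraction.
  - by move=> y; exact: affine_commute.
  - by move=> y; exact: affine_commute.
  - by move=> y; rewrite affine_form Re_EC; have := le1 y; lra.
  - by move=> y; rewrite affine_form Re_EC; have := ge1 y; lra.
  - by rewrite subr_gt0.
  - by rewrite ltrD2l ltrN2.
apply: (@growth_separation _ _ (affine c 1) (E S') (E S) T (c + b) (c + a)) => //.
- by apply: Epos; left.
- by move=> y; exact: pm_contraction.
- by move=> y; exact: affine_commute.
- by move=> y; exact: affine_commute.
- by move=> y; rewrite affine_form Re_EC; have := ge1 y; lra.
- by move=> y; rewrite affine_form Re_EC; have := le1 y; lra.
- lra.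
- by rewrite ltrD2l.
Qed.

Let kill_series (W : K -> K) (u : nat -> K) l : bounded_op W ->
  series u @ \oo --> l -> (forall n, W (u n) = 0) -> W l = 0.
Proof.
move=> /bounded_opP[lW [c c0 Wc]] /hcvgP ul Wu; apply: eq_of_hnorm_lt => e e0.
have [N /(_ N (leqnn N)) hN] := ul _ (divr_gt0 e0 c0).
have Ws : W (series u N) = 0.
  by rewrite /series /= linear_fun_sum // big1.
rewrite -Ws -(linear_funB lW); apply: (le_lt_trans (Wc _)).
by rewrite hnormBC mulrC -ltr_pdivlMr.
Qed.

(** The half-line is a countable disjoint union of sets at a positive distance
    from its complement, and these are separated from the complement. *)
Lemma commute_half_line a x :
  T (E `]a, +oo[%classic x) = E `]a, +oo[%classic (T x).
Proof.
set P := `]a, +oo[%classic; set C := ~` P.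
have mP : measurable P by exact: measurable_itv.
have mC : measurable C by exact: measurableC.
have CE : C = `]-oo, a]%classic by rewrite /C /P setCitvr.
pose F n := `[a + n.+1%:R^-1, +oo[%classic : set R.
have mF n : measurable (F n) by exact: measurable_itv.
have PE : P = \bigcup_n seqDU F n by rewrite -seqDU_bigcup_eq -itvoyEbigcup.
have mS n : measurable (seqDU F n).
  by apply: measurableD => //; apply: bigsetU_measurable.
have sep n y : E C (T (E (seqDU F n) y)) = 0 /\ E (seqDU F n) (T (E C y)) = 0.
  apply: (@commutant_separated a (a + n.+1%:R^-1)) => //.
  - by rewrite ltrDl invr_gt0.
  - by move=> t; rewrite CE /= in_itv.
  - by move=> t St; have := @subset_seqDU _ F n t St; rewrite /F /= in_itv /= andbT.
have ser y := @pm_sigma_additive _ _ _ pE _ mS (@trivIset_seqDU _ F) y.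
rewrite -PE in ser.
have CP y : E C (T (E P y)) = 0.
  have bW : bounded_op (E C \o T) by apply: bounded_op_comp => //; exact: pm_bounded.
  by apply: (kill_series bW (ser y)) => n; exact: (sep n y).1.
have PC y : E P (T (E C y)) = 0.
  apply: (kill_series (bounded_op_id K) (ser (T (E C y)))) => n.
  exact: (sep n y).2.
have := CP x; rewrite pm_setC // => /subr0_eq ->.
have := PC x; rewrite pm_setC // (linear_funB bT.1) (linear_funB (pm_linear pE mP)).
by move=> /subr0_eq.
Qed.

(** Fuglede's theorem for a bounded self-adjoint operator: the sets whose
    projection commutes with T form a Dynkin system which contains the
    half-lines. *)
Theorem commute_spectral_projection S x : measurable S ->
  T (E S x) = E S (T x).
Proof.
move=> mS; move: S mS x.
have mE : @measurable _ R = <<s @RGenOInfty.G R >>.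
  exact: RGenOInfty.measurableE.
rewrite mE.
apply: (@dynkin_induction _ R _ (fun S => forall x, T (E S x) = E S (T x)) mE).
- move=> _ _ [a ->] [b ->]; exists (Num.max a b).
  by apply/seteqP; split => t /=; rewrite !in_itv /= !andbT gt_max;
    [move=> [-> ->]|move=> /andP[]].
- by move=> x; rewrite !pm_setT.
- by move=> _ [a ->] x; exact: commute_half_line.
- by move=> S mS TS x; rewrite !pm_setC // (linear_funB bT.1) TS.
- move=> F mF tF TF x.
  have c1 := @pm_sigma_additive _ _ _ pE _ mF tF (T x).
  have c2 : T \o series (fun n => E (F n) x) @ \oo --> T (E (\bigcup_n F n) x).
    apply: continuous_cvg; first exact: bT.2.
    exact: (@pm_sigma_additive _ _ _ pE _ mF tF x).
  have cE : T \o series (fun n => E (F n) x) = series (fun n => E (F n) (T x)).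
    apply/funext => n; rewrite /series /= (linear_fun_sum _ _ bT.1).
    by apply: eq_bigr => k _; exact: TF.
  rewrite cE in c2.
  exact: (cvg_unique (@norm_hausdorff _ K) c2 c1).
Qed.

End Fuglede.

(** This is where affiliation comes from: the lift of an element of N' commutes
    with A, hence with its spectral projections, and so their compressions lie
    in N'' = N. *)
Lemma compressed_projection_mem (R : realType) (L H K : hilbertType R)
    (M : set (L -> L)) (N : set (H -> H)) (pi : (L -> L) -> K -> K)
    (V : H -> K) (A : K -> K) (E : set R -> K -> K) S :
  von_neumann_algebra M -> von_neumann_algebra N ->
  unital_star_rep M pi -> bounded_op V ->
  (forall x, M x -> N (adjoint V \o pi x \o V)) ->
  closure [set k | exists n (X : 'I_n -> L -> L) (h : 'I_n -> H),
    (forall i, M (X i)) /\ k = \sum_i pi (X i) (V (h i))] = setT ->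
  commutant (pi @` M) A ->
  (forall x, M x -> N (adjoint V \o A \o pi x \o V)) ->
  positive_op A -> projection_measure E -> spectral_measure_of A E ->
  measurable S -> N (adjoint V \o E S \o V).
Proof.
move=> vM vN rep bV NG cl cA NA pA pE sA mS.
apply/(vN_commutant2 vN); split=> [|X cX].
  apply: (bounded_op_comp (bounded_op_comp (adjoint_bounded bV) _) bV).
  exact: (pm_bounded pE mS).
have [T [bT TV VT TA]] := commutant_lift vM vN rep bV NG cl cX.
have {}TA x : T (A x) = A (T x) by have /(congr1 (@^~ x)) := TA A cA NA.
apply/funext => h /=.
have /(congr1 (@^~ h)) /= <- := TV.
rewrite -(commute_spectral_projection pE sA cA.1 pA bT TA) //.
by have /(congr1 (@^~ (E S (V h)))) := VT.
Qed.

(** * Normal functionals and bounded strong convergence *)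

Section NormalFunctionals.
Context (R : realType) (H : hilbertType R).

Lemma square_summable_tail (xi : nat -> H) (e : R) : square_summable xi -> 0 < e ->
  exists J, forall m n, (J <= m)%N -> \sum_(m <= j < n) hnorm (xi j) ^+ 2 <= e.
Proof.
move=> sxi e0; pose f j : \bar R := (hnorm (xi j) ^+ 2)%:E.
have {}sxi : (\sum_(n <oo) f n < +oo)%E.
  by move: sxi; rewrite /square_summable; under eq_eseriesr do rewrite innerxx Re_EC.
have f0 j : (0 <= f j)%E by rewrite lee_fin sqr_ge0.
have [] := @nneseries_tail_cvg _ _ _ sxi (fun j _ => f0 j) [set y | (y < e%:E)%E].
  by apply: open_nbhs_nbhs; split; [exact: open_ereal_lt_ereal|rewrite /= lte_fin].
move=> J _ hJ; exists J => m n /hJ /= me.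
rewrite -lee_fin -sumEFin; apply: le_trans (ltW me).
by apply: (@nneseries_lim_ge _ f xpredT) => j _ _; exact: f0.
Qed.

(** Dominated convergence for the series which defines the seminorm: finitely
    many terms are small by strong convergence, and the tail is dominated by
    square-summable sequences. *)
Lemma sigma_weak_seminorm_lt (xi eta : nat -> H) (Y : nat -> H -> H) (c d : R) :
  square_summable xi -> square_summable eta -> 0 < c -> 0 < d ->
  (forall n h, hnorm (Y n h) <= c * hnorm h) ->
  (forall h (e : R), 0 < e ->
     exists n0, forall n, (n0 <= n)%N -> hnorm (Y n h) < e) ->
  exists n0, forall n, (n0 <= n)%N -> sigma_weak_seminorm xi eta (Y n) < d%:C.
Proof.
move=> sxi seta c0 d0 Yc Y0.
pose e := d / (8 * c); have e0 : 0 < e by rewrite divr_gt0 // mulr_gt0.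
have [J1 hJ1] := square_summable_tail sxi e0.
have [J2 hJ2] := square_summable_tail seta e0.
pose J := maxn J1 J2; pose b := d / (4 * J.+1%:R).
have b0 : 0 < b by rewrite divr_gt0 // mulr_gt0.
have /choice[m hm] : forall j, exists n0, forall n, (n0 <= n)%N ->
    hnorm (Y n (xi j)) * hnorm (eta j) <= b.
  move=> j; have p0 : 0 < hnorm (eta j) + 1 by rewrite ltr_wpDl ?hnorm_ge0.
  have [n0 hn0] := Y0 (xi j) _ (divr_gt0 b0 p0).
  exists n0 => n /hn0; rewrite ltr_pdivlMr // => /ltW; apply: le_trans.
  by rewrite ler_wpM2l ?hnorm_ge0 // lerDl.
exists (\max_(j < J) m j)%N => n hn.
set t := fun j => inner (Y n (xi j)) (eta j) : R[i]^o.
rewrite /sigma_weak_seminorm -/t.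
(* The default value of the limit of a divergent series is 0. *)
have [cv|dv] := pselect (cvgn (series t)); last first.
  by rewrite (dvgP dv) normr0 ltcR.
set l := limn (series t).
have tj j : complex.Re `|t j : R[i]| <= hnorm (Y n (xi j)) * hnorm (eta j).
  exact: norm_inner_le.
have head : \sum_(0 <= j < J) complex.Re `|t j : R[i]| <= d / 4.
  apply: (@le_trans _ _ (\sum_(0 <= j < J) b)).
    rewrite big_nat [leRHS]big_nat; apply: ler_sum => j /andP[_ jJ].
    apply: (le_trans (tj j)); apply: hm; apply: leq_trans hn.
    exact: (leq_bigmax (Ordinal jJ)).
  rewrite sumr_const_nat subn0 -[b *+ J]mulr_natr /b.
  have -> : d / (4 * J.+1%:R) * J%:R = d / 4 * (J%:R / J.+1%:R).
    by rewrite invfM; ring.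
  have d4 : 0 <= d / 4 by rewrite divr_ge0 // ltW.
  by rewrite ler_piMr // ler_pdivrMr // mul1r ler_nat.
have tail N : (J <= N)%N -> \sum_(J <= j < N) complex.Re `|t j : R[i]| <= d / 4.
  move=> JN; have h1 := hJ1 J N (leq_maxl _ _); have h2 := hJ2 J N (leq_maxr _ _).
  have -> : d / 4 = c * (e + e) by rewrite /e; field; rewrite gt_eqF.
  apply: (@le_trans _ _ (c * (\sum_(J <= j < N) hnorm (xi j) ^+ 2 +
                              \sum_(J <= j < N) hnorm (eta j) ^+ 2))).
    rewrite -big_split mulr_sumr /=; apply: ler_sum => j _.
    apply: (le_trans (tj j)).
    apply: (@le_trans _ _ (c * hnorm (xi j) * hnorm (eta j))).
      by rewrite ler_wpM2r ?hnorm_ge0.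
    rewrite -mulrA ler_pM2l //.
    have := sqr_ge0 (hnorm (xi j) - hnorm (eta j)).
    have := sqr_ge0 (hnorm (xi j) + hnorm (eta j)); nra.
  by rewrite ler_pM2l // lerD.
have q0 : 0 < (d / 4)%:C :> R[i] by rewrite ltcR divr_gt0.
have /cvgrPdist_lt/(_ _ q0)[N _ hN] : series t @ \oo --> l by exact: cv.
pose N' := maxn J N; have /= := hN N' (leq_maxr _ _).
have lN : `|l : R[i]| <= `|l - series t N'| + `|series t N'|.
  by rewrite -[X in `|X| <= _](subrK (series t N')) ler_normD.
have sN : `|series t N' : R[i]| <= (d / 2)%:C.
  rewrite norm_EC lecR.
  apply: (@le_trans _ _ (\sum_(0 <= j < N') complex.Re `|t j : R[i]|)).
    apply: (big_rec2 (fun (x : R[i]) y => complex.Re `|x| <= y)) => [|j y1 y2 _ h].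
      by rewrite normr0.
    rewrite -lecR -norm_EC; apply: (le_trans (ler_normD _ _)).
    by rewrite rmorphD /= -norm_EC lerD2l (norm_EC y1) lecR.
  rewrite (big_cat_nat (n := J)) //= ?leq_maxl //.
  have -> : d / 2 = d / 4 + d / 4 by field.
  by apply: lerD head _; apply: tail; exact: leq_maxl.
move=> dist; apply: (le_lt_trans lN); apply: (le_lt_trans (lerD (lexx _) sN)).
apply: (lt_le_trans (ltr_leD dist (lexx _))).
by rewrite -rmorphD lecR; move: d0; lra.
Qed.

End NormalFunctionals.

(** * Positive operator valued measures *)

Section OperatorValuedMeasure.
Context (R : realType) (H : hilbertType R).
Implicit Types (N : set (H -> H)) (G : set R -> H -> H).

(** A positive operator valued measure; its bound c is kept explicit because it
    enters Lipschitz constants. *)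
Definition povm N G (c : R) : Prop :=
  [/\ forall S, measurable S -> N (G S) /\ positive_op (G S),
      G set0 = 0,
      forall S, measurable S -> forall h, hnorm (G S h) <= c * hnorm h
    & forall S : nat -> set R, (forall n, measurable (S n)) -> trivIset setT S ->
        forall h, series (fun n => G (S n) h) @ \oo --> G (\bigcup_n S n) h].

Section Predual.
Context N (vN : von_neumann_algebra N).

Lemma vN_0 : N 0.
Proof. by rewrite -(subrr (idfun : H -> H)); apply: (vN_sub vN); exact: vN_id. Qed.

Lemma predual0 phi : predual N phi -> phi 0 = 0.
Proof.
case=> _ lphi _; have := lphi (-1) 0 0 vN_0 vN_0.
by rewrite scaler0 addr0 mulN1r addNr.
Qed.

Lemma predualD phi X Y : predual N phi -> N X -> N Y -> phi (X + Y) = phi X + phi Y.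
Proof. by case=> _ lphi _ NX NY; have := lphi 1 X Y NX NY; rewrite scale1r mul1r. Qed.

Lemma predualZ phi a X : predual N phi -> N X -> phi (a *: X) = a * phi X.
Proof.
move=> pphi NX; have [_ lphi _] := pphi.
by have := lphi a X 0 NX vN_0; rewrite addr0 (predual0 pphi) addr0.
Qed.

Lemma predualB phi X Y : predual N phi -> N X -> N Y -> phi (X - Y) = phi X - phi Y.
Proof.
move=> pphi NX NY; rewrite predualD //; last exact: (vN_opp vN).
by rewrite -scaleN1r predualZ // mulN1r.
Qed.

(** On bounded sequences strong convergence implies sigma-weak convergence, and
    normal functionals are continuous for the latter. *)
Lemma predual_strong_cvg phi (X : nat -> H -> H) X0 (c : R) : predual N phi ->
  (forall n, N (X n)) -> N X0 ->
  (forall n h, hnorm (X n h) <= c * hnorm h) ->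
  (forall h, hnorm (X0 h) <= c * hnorm h) ->
  (forall h, (fun n => X n h) @ \oo --> X0 h) ->
  forall e : R, 0 < e -> exists n0, forall n, (n0 <= n)%N ->
    `|phi (X n) - phi X0| < e%:C.
Proof.
move=> [_ _ cphi] NX NX0 Xc X0c XX0 e e0.
have e0' : 0 < e%:C :> R[i] by rewrite ltcR.
have [k [xi [eta [_ [sq /real_gt0_EC[d d0 ->] small]]]]] := cphi X0 NX0 _ e0'.
have c1 : 0 < `|2 * c| + 1 by rewrite ltr_wpDl.
have /choice[m hm] : forall i : 'I_k, exists n0, forall n, (n0 <= n)%N ->
    sigma_weak_seminorm (xi i) (eta i) (X n - X0) < d%:C.
  move=> i; have [sxi seta] := sq i.
  apply: (sigma_weak_seminorm_lt sxi seta c1 d0) => [n h|h e' e'0].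
    apply: (@le_trans _ _ (2 * c * hnorm h)).
      apply: (le_trans (hnorm_leB (X n h) (X0 h))).
      by have := Xc n h; have := X0c h; lra.
    rewrite ler_wpM2r ?hnorm_ge0 // (le_trans (ler_norm _)) // lerDl //.
  exact: ((hcvgP _ _).1 (XX0 h) e' e'0).
exists (\max_i m i)%N => n hn; apply: small => // i.
by apply: hm; apply: leq_trans hn; exact: leq_bigmax.
Qed.

(** Composing with a normal functional turns strong sigma-additivity into scalar
    sigma-additivity. *)
Lemma povm_measure G c phi : povm N G c -> predual_pos N phi ->
  exists mu : {measure set R -> \bar R},
    forall S, measurable S -> mu S = (complex.Re (phi (G S)))%:E.
Proof.
move=> [NG G0 Gc GU] [pphi phi_ge0].
apply: (@measure_of_additive _ (fun S => complex.Re (phi (G S)))) => [|S mS|S mS tS].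
- by rewrite G0 predual0.
- by have [NS pS] := NG S mS; apply: le0_Re; exact: phi_ge0.
pose X n : H -> H := \sum_(0 <= k < n) G (S k).
have NX n : N (X n).
  rewrite /X; apply: (big_ind N) => [|Y Z|k _]; first exact: vN_0.
    exact: (vN_add vN).
  exact: (NG _ (mS k)).1.
have XE n h : X n h = series (fun k => G (S k) h) n.
  by rewrite /X /series /= fct_sumE.
have mU : measurable (\bigcup_n S n) by exact: bigcup_measurable.
(* Partial sums are themselves values of G, hence bounded by c: pad the first
   n sets with empty ones. *)
have XG n : exists2 U, measurable U & X n = G U.
  pose S' k := if (k < n)%N then S k else set0.
  have mS' k : measurable (S' k) by rewrite /S'; case: ifP.
  have tS' : trivIset setT S'.
    apply/trivIsetP => i j _ _ ij; rewrite /S'; case: ifP => _; last by rewrite set0I.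
    by case: ifP => _; [move/trivIsetP : tS; exact|rewrite setI0].
  exists (\bigcup_k S' k); first exact: bigcup_measurable.
  apply/funext => h; have c1 := GU _ mS' tS' h.
  apply: (cvg_unique (@norm_hausdorff _ H) _ c1).
  apply/hcvgP => e e0; exists n => p np.
  suff -> : series (fun k => G (S' k) h) p = X n h by rewrite subrr hnorm0.
  rewrite XE /series /= (big_cat_nat (n := n)) //=.
  rewrite [X in _ + X]big1_seq ?addr0.
    by apply: eq_big_nat => k /andP[_ kn]; rewrite /S' kn.
  move=> k; rewrite mem_index_iota => /andP[_ /andP[nk _]].
  by rewrite /S' ltnNge nk /= G0.
have Xc n h : hnorm (X n h) <= c * hnorm h.
  by have [U mU' ->] := XG n; exact: Gc.
apply/cvgrPdist_lt => e e0.
have XX0 h : (fun n => X n h) @ \oo --> G (\bigcup_n S n) h.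
  rewrite (_ : (fun n => X n h) = series (fun k => G (S k) h)); first exact: GU.
  by apply/funext => n; exact: XE.
have [n0 hn0] := predual_strong_cvg pphi NX (NG _ mU).1 Xc (Gc _ mU) XX0 e0.
exists n0 => // n /hn0 {}hn0 /=.
have -> : series ((fun T => complex.Re (phi (G T))) \o S) n = complex.Re (phi (X n)).
  rewrite /series /= -Re_sum; congr complex.Re; rewrite /X.
  elim: n {hn0} => [|n ih]; first by rewrite !big_geq // predual0.
  have NXn := NX n; rewrite /X in NXn.
  by rewrite !big_nat_recr //= ih predualD //; exact: (NG _ (mS n)).1.
rewrite distrC -ReB -ltcR; apply: le_lt_trans hn0.
by rewrite [leRHS]norm_EC lecR Re_le_norm.
Qed.

End Predual.
End OperatorValuedMeasure.

Lemma povm_compression (R : realType) (H K : hilbertType R)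
    (N : set (H -> H)) (V : H -> K) (E : set R -> K -> K) :
  bounded_op V -> projection_measure E ->
  (forall S, measurable S -> N (adjoint V \o E S \o V)) ->
  exists2 c : R, 0 < c & povm N (fun S => adjoint V \o E S \o V) c.
Proof.
move=> bV pE GN.
have [lV [d d0 Vd]] := (bounded_opP V).1 bV.
have [laV [d' d'0 aVd]] := (bounded_opP _).1 (adjoint_bounded bV).
exists (d' * d); first exact: mulr_gt0.
split=> [S mS||S mS h|S mS tS h].
- split=> [|h]; first exact: GN.
  rewrite /= adjointPr // (_ : inner _ _ = inner (E S (V h)) (E S (V h))).
    by rewrite innerxx ler0c sqr_ge0.
  by rewrite [RHS](pm_selfadjoint pE) // (pm_idem pE) // (pm_selfadjoint pE).
- by apply/funext => h; rewrite /= (pm_set0 pE) (linear_fun0 laV).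
- rewrite /= -mulrA; apply: (le_trans (aVd _)); rewrite ler_pM2l //.
  by apply: le_trans (Vd h); exact: (pm_contraction pE).
- have -> : series (fun n => (adjoint V \o E (S n) \o V) h) =
      adjoint V \o series (fun n => E (S n) (V h)).
    by apply/funext => n; rewrite /series /= (linear_fun_sum _ _ laV).
  apply: continuous_cvg; first exact: (adjoint_bounded bV).2.
  exact: (@pm_sigma_additive _ _ _ pE _ mS tS (V h)).
Qed.

(** * Integrals against a positive operator valued measure *)

Import HBNNSimple.

Section IntegralShift.
Context (R : realType) (mu : {measure set R -> \bar R}) (D : set R).
Hypothesis mD : measurable D.
Variables (g : R -> \bar R) (l v : R).
Hypotheses (mg : measurable_fun D g) (l0 : 0 <= l).
Hypotheses (gl : forall t, D t -> ((- l)%:E <= g t)%E) (muD : mu D = v%:E).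

(** A function bounded below may have the integral +oo, so the usual linearity
    for integrable functions does not apply; the identity follows from
    additivity on the nonnegative functions g + l, l and the two parts of g. *)
Lemma integral_shift :
  (\int[mu]_(t in D) g t = \int[mu]_(t in D) (g t + l%:E) - (l * v)%:E)%E.
Proof.
have shift_ge0 t : D t -> (0 <= g t + l%:E)%E.
  by move=> Dt; have := gl Dt; rewrite -leeBlDr // sub0e.
have mshift : measurable_fun D (fun t => g t + l%:E)%E.
  by apply: emeasurable_funD => //; exact: measurable_cst.
have mpos := measurable_funepos mg; have mneg := measurable_funeneg mg.
have eqI : (\int[mu]_(t in D) (g t + l%:E) + \int[mu]_(t in D) (g^\- t) =
    \int[mu]_(t in D) (g^\+ t) + (l * v)%:E)%E.
  have -> : (l * v)%:E = (\int[mu]_(t in D) l%:E)%E.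
    by rewrite integral_cst // muD.
  rewrite -ge0_integralD // -ge0_integralD //.
  apply: eq_integral => t /set_mem Dt; rewrite funeposE funenegE.
  have := gl Dt; case: (g t) => [r| |] //=; last by rewrite maxNye maxye addye //= adde0.
  move=> _; rewrite -!EFin_max -!EFinD; congr EFin.
  by rewrite /Order.max; do 2!case: ltP => ?; lra.
have neg_fin : (\int[mu]_(t in D) (g^\- t) \is a fin_num)%E.
  rewrite ge0_fin_numE; last by apply: integral_ge0.
  apply: (@le_lt_trans _ _ (\int[mu]_(t in D) l%:E)%E).
    apply: ge0_le_integral => // t Dt.
    by rewrite funenegE ge_max lee_fin l0 andbT leeNl -EFinN gl.
  by rewrite integral_cst // muD -EFinM ltry.
rewrite integralE; move: eqI neg_fin.
move: (\int[mu]_(t in D) (g t + l%:E))%E (integral mu D (g^\+)%E) => s p.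
move: (integral mu D (g^\-)%E) => [n| |] // + _.
by move: s p => [s| |] [p| |] //= [] ?; congr EFin; lra.
Qed.

End IntegralShift.

Section ExtendedLowerBounded.
Context (R : realType) (H : hilbertType R).
Context (N : set (H -> H)) (vN : von_neumann_algebra N).
Context (G : set R -> H -> H) (c : R).
Hypotheses (c0 : 0 < c) (GN : povm N G c).
Context (D : set R) (g : R -> \bar R) (l : R).
Hypotheses (mD : measurable D) (mg : measurable_fun D g) (l0 : 0 <= l).
Hypotheses (gl : forall t, D t -> ((- l)%:E <= g t)%E).

(** Only the values of phi on the range of G enter, which is what allows a
    functional on B(H) to be replaced by its restriction to N. *)
Definition povm_integral (phi : (H -> H) -> R[i]) : \bar R :=
  (\int[fun S => (complex.Re (phi (G S)))%:E]_(t in D) g t)%E.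

Let shift t := (g t + l%:E)%E.

Let shift_ge0 t : D t -> (0 <= shift t)%E.
Proof. by move=> Dt; have := gl Dt; rewrite /shift -leeBlDr // sub0e. Qed.

Let mshift : measurable_fun D shift.
Proof. by apply: emeasurable_funD => //; exact: measurable_cst. Qed.

Let mass (phi : (H -> H) -> R[i]) : R := l * complex.Re (phi (G D)).

Let povm_integralE phi (mu : {measure set R -> \bar R}) :
  (forall S, measurable S -> mu S = (complex.Re (phi (G S)))%:E) ->
  povm_integral phi = (\int[mu]_(t in D) shift t - (mass phi)%:E)%E.
Proof.
move=> muE; rewrite -(integral_shift mD mg l0 gl (muE D mD)).
by apply: eq_integral_measurable => S mS; rewrite muE.
Qed.

Let norm_bound phi psi X (d : R) : predual N phi -> predual N psi -> N X ->
  (forall h, hnorm (X h) <= c * hnorm h) ->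
  (functional_norm N (psi - phi)%R < d%:E)%E ->
  `|complex.Re (psi X) - complex.Re (phi X)| <= c * d.
Proof.
move=> pphi ppsi NX Xc lt.
pose Y := (c^-1)%:C *: X.
have NY : N Y by exact: (vN_scale vN).
have XE (chi : (H -> H) -> R[i]) : predual N chi -> complex.Re (chi X) = c * complex.Re (chi Y).
  by move=> pchi; rewrite (predualZ vN) // ReZ mulrA divff ?mul1r // gt_eqF.
rewrite (XE phi) // (XE psi) // -mulrBr normrM gtr0_norm // ler_pM2l // -ReB.
apply: (le_trans (Re_le_norm _)); rewrite -lee_fin; apply: le_trans (ltW lt).
apply: ereal_sup_ubound; exists Y => //; split=> // h.
rewrite !hnormE lecR hnorm_scale Re_norm_EC gtr0_norm ?invr_gt0 //.
by rewrite ler_pdivrMl.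
Qed.

Lemma povm_integral_ge phi : predual_pos N phi ->
  (- (mass phi)%:E <= povm_integral phi)%E.
Proof.
move=> pphi; have [mu muE] := povm_measure vN GN pphi.
by rewrite (povm_integralE muE) leeDr // integral_ge0.
Qed.

(** The integral of the nonnegative function g + l is the supremum of the
    integrals of simple functions below it, and each of these is a finite linear
    combination of values phi (G S), hence norm continuous in phi. *)
Lemma povm_integral_lsc phi r : predual_pos N phi ->
  (r%:E < povm_integral phi)%E -> exists2 d : R, 0 < d &
    forall psi, predual_pos N psi ->
      (functional_norm N (psi - phi)%R < d%:E)%E -> (r%:E < povm_integral psi)%E.
Proof.
move=> pphi; have [mu muE] := povm_measure vN GN pphi.
rewrite (povm_integralE muE) lteBrDr // -EFinD ge0_integralE //.
move=> /ereal_sup_gt[_ [h hle <-]].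
pose s : seq R := finmap.enum_fset (fset_set (range h)).
pose level (chi : (H -> H) -> R[i]) :=
  \sum_(x <- s) x * complex.Re (chi (G (h @^-1` [set x]))).
have levelE chi (nu : {measure set R -> \bar R}) :
    (forall S, measurable S -> nu S = (complex.Re (chi (G S)))%:E) ->
    sintegral nu h = (level chi)%:E.
  move=> nuE; rewrite sintegralE fsbig_finite //= -sumEFin.
  by apply: eq_bigr => x _; rewrite nuE.
rewrite (levelE _ _ muE) lte_fin -ltrBrDr => rlt.
(* the Lipschitz constant of level - mass in the norm of the predual, plus 1
   to make it positive *)
pose C := (\sum_(x <- s) `|x| + l) * c + 1.
have C0 : 0 < C.
  by rewrite ltr_wpDl // mulr_ge0 // ?addr_ge0 ?sumr_ge0 // ltW.
exists ((level phi - mass phi - r) / C); first by rewrite divr_gt0 // subr_gt0.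
move=> psi ppsi; set d := _ / C => lt.
have d0 : 0 < d by rewrite divr_gt0 // subr_gt0.
have [nu nuE] := povm_measure vN GN ppsi.
rewrite (povm_integralE nuE) lteBrDr // -EFinD ge0_integralE //.
apply: (@lt_le_trans _ _ (sintegral nu h)); last first.
  by apply: ereal_sup_ubound; exists h.
rewrite (levelE _ _ nuE) lte_fin -ltrBrDr.
have [hG _ Gc _] := GN.
have bd S : measurable S ->
    `|complex.Re (psi (G S)) - complex.Re (phi (G S))| <= c * d.
  by move=> mS; apply: norm_bound lt; [exact: pphi.1|exact: ppsi.1|
    exact: (hG _ mS).1|exact: Gc].
have b1 : `|level psi - level phi| <= (\sum_(x <- s) `|x|) * (c * d).
  rewrite /level -sumrB mulr_suml; apply: (le_trans (ler_norm_sum _ _ _)).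
  by apply: ler_sum => x _; rewrite -mulrBr normrM ler_wpM2l // bd.
have b2 : `|mass psi - mass phi| <= l * (c * d).
  by rewrite /mass -mulrBr normrM ger0_norm // ler_wpM2l // bd.
have b3 : (\sum_(x <- s) `|x| + l) * c * d < level phi - mass phi - r.
  rewrite [ltRHS](_ : _ = C * d); last by rewrite mulrC divfK // gt_eqF.
  by rewrite ltr_pM2r // /C ltrDl.
move: b1 b2 b3; rewrite !ler_norml => /andP[b1 _] /andP[_ b2] b3.
move: b3; rewrite mulrDl mulrDl -!mulrA; lra.
Qed.

Lemma povm_integral_ext_lb : ext_lb N povm_integral.
Proof.
have [hG _ Gc _] := GN.
split.
- move=> phi pphi; apply/eqP; rewrite gt_eqF //.
  by apply: lt_le_trans (povm_integral_ge pphi); rewrite ltNye.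
- move=> a phi a0 pphi; have [mu muE] := povm_measure vN GN pphi.
  pose k := NngNum a0.
  pose nu : {measure set R -> \bar R} := mscale k mu.
  have nuE S : measurable S -> nu S = (complex.Re ((fun X => a%:C * phi X) (G S)))%:E.
    by move=> mS; rewrite /nu /= /mscale /= muE // -EFinM ReZ.
  rewrite (povm_integralE nuE) (povm_integralE muE) /nu ge0_integral_mscale //.
  rewrite [RHS]muleBr // ?fin_num_adde_defl //; congr (_ - _)%E.
  by rewrite -EFinM /mass ReZ; congr EFin; ring.
- move=> phi psi pphi ppsi; have [mu muE] := povm_measure vN GN pphi.
  have [nu nuE] := povm_measure vN GN ppsi.
  pose rho : {measure set R -> \bar R} := measure_add mu nu.
  have rhoE S : measurable S -> rho S = (complex.Re ((phi + psi) (G S)))%:E.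
    move=> mS; have -> : rho S = (mu S + nu S)%E by exact: measure_addE.
    by rewrite muE // nuE // -EFinD -ReD.
  rewrite (povm_integralE rhoE) (povm_integralE muE) (povm_integralE nuE).
  rewrite /rho ge0_integral_measure_add //.
  have -> : mass (phi + psi) = mass phi + mass psi by rewrite /mass ReD mulrDr.
  by rewrite EFinD oppeD // addeACA.
- by move=> phi pphi r; exact: povm_integral_lsc.
- exists (- (l * c)) => phi pphi; apply: le_trans (povm_integral_ge pphi).
  rewrite -EFinN lee_fin mulNr lerN2 /mass -mulrA ler_wpM2l //.
  have [pp pos] := pphi.
  have [NGD pGD] := hG D mD; have NI := vN_id vN.
  have NX : N (c%:C *: idfun - G D) by apply: (vN_sub vN) => //; exact: (vN_scale vN).
  have /(pos _ NX)/le0_Re : positive_op (c%:C *: (idfun : H -> H) - G D).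
    move=> x; have -> : (c%:C *: (idfun : H -> H) - G D) x = c%:C *: x - G D x by [].
    rewrite innerBl innerZl innerxx (ge0_ReE (pGD x)) -rmorphM -rmorphB ler0c subr_ge0.
    apply: (le_trans (Re_inner_le _ _)); rewrite expr2 mulrA.
    by rewrite ler_wpM2r ?hnorm_ge0 // Gc.
  by rewrite (predualB vN) // ?(predualZ vN) // ?ReB ?ReZ ?subr_ge0 //; exact: (vN_scale vN).
Qed.

End ExtendedLowerBounded.

(** * Perspectives of operator convex functions *)

Section OperatorConvexFunctions.
Context (R : realType) (f : R -> R).

Let hermitian_scalar (a : R) : (a%:C%:M : 'M[R[i]]_1) \is hermsymmx.
Proof.
apply/is_hermitianmxP; rewrite expr0 scale1r tr_scalar_mx map_scalar_mx /=.
by rewrite conj_Creal // complex_real.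
Qed.

Lemma mx_fun_scalar (a : R) : mx_fun f (a%:C%:M : 'M[R[i]]_1) = (f a)%:C%:M.
Proof.
set A := (a%:C%:M : 'M[R[i]]_1).
have unitP : spectralmx A \in unitmx := spectral_unit A.
have diag (d : 'rV[R[i]]_1) :
    invmx (spectralmx A) *m diag_mx d *m spectralmx A = (d 0 0)%:M.
  have -> : diag_mx d = (d 0 0)%:M by apply/matrixP => i j; rewrite !ord1 !mxE.
  by rewrite scalar_mxC -mulmxA mulVmx // mulmx1.
have := orthomx_spectralP (hermitian_normalmx (hermitian_scalar a)).
rewrite diag => /matrixP/(_ 0 0); rewrite !mxE /= !mulr1n => dE.
by rewrite /mx_fun diag !mxE -dE Re_EC.
Qed.

Hypothesis cf : operator_convex f.

Let pos_spectrum_scalar (a : R) : 0 < a ->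
  hermitian_pos_spectrum (a%:C%:M : 'M[R[i]]_1).
Proof.
move=> a0; split=> // z /eigenvalueP[v]; rewrite mul_mx_scalar => vz vn0.
suff <- : a%:C = z by rewrite ltcR.
apply/eqP; rewrite -subr_eq0; have := vn0; apply: contraR => az.
have : (a%:C - z) *: v = 0 by rewrite scalerBl vz subrr.
by move/eqP; rewrite scaler_eq0 (negbTE az).
Qed.

(** Operator convexity for matrices of size 1. *)
Lemma operator_convex_convex (x y t : R) : 0 < x -> 0 < y -> 0 <= t <= 1 ->
  f (t * x + (1 - t) * y) <= t * f x + (1 - t) * f y.
Proof.
move=> x0 y0 t01.
have := cf (pos_spectrum_scalar x0) (pos_spectrum_scalar y0) t01.
have E (p q : R) : t%:C *: (p%:C%:M : 'M[R[i]]_1) + (1 - t)%:C *: q%:C%:M =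
    (t * p + (1 - t) * q)%:C%:M.
  by rewrite !scale_scalar_mx -!rmorphM -raddfD -rmorphD.
rewrite !(E, mx_fun_scalar) /mx_le -raddfB -rmorphB => /(_ (const_mx 1)).
rewrite dotmxE mul_mx_scalar -scalemxAl mxE mxE big_ord1 !mxE.
by rewrite conjC1 !mulr1 ler0c subr_ge0.
Qed.

(* Chords of f from 1 to 2 and from 1/2 to 1, extended beyond the point 1, are
   minorants of f on (0, 1] and on [1, +oo) respectively. *)
Let slope1 := f 2 - f 1.
Let slope2 := 2 * (f 1 - f 2^-1).

Let minorant1 u : 0 < u -> u <= 1 -> f 1 + slope1 * (u - 1) <= f u.
Proof.
move=> u0 u1; have d0 : 0 < 2 - u by lra.
have t01 : 0 <= (2 - u)^-1 <= 1.
  by rewrite invr_ge0 (ltW d0) invf_le1 //; lra.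
have := operator_convex_convex u0 (ltr0n _ 2) t01.
have -> : (2 - u)^-1 * u + (1 - (2 - u)^-1) * 2 = 1 by field; rewrite gt_eqF.
rewrite -(ler_pM2l d0) mulrDr !mulrA mulrBr divff ?gt_eqF //.
rewrite /slope1; lra.
Qed.

Let minorant2 u : 1 <= u -> f 1 + slope2 * (u - 1) <= f u.
Proof.
move=> u1; have d0 : 0 < 2 * u - 1 by lra.
have u0 : 0 < u by lra.
have h0 : 0 < 2^-1 :> R by rewrite invr_gt0.
have t01 : 0 <= (2 * u - 1)^-1 <= 1.
  by rewrite invr_ge0 (ltW d0) invf_le1 //; lra.
have := operator_convex_convex u0 h0 t01.
have -> : (2 * u - 1)^-1 * u + (1 - (2 * u - 1)^-1) * 2^-1 = 1.
  by field; rewrite gt_eqF.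
rewrite -(ler_pM2l d0) mulrDr !mulrA mulrBr divff ?gt_eqF //.
rewrite /slope2; lra.
Qed.

Let l := `|f 1| + `|slope1| + `|slope2|.

Let l0 : 0 <= l. Proof. by rewrite /l !addr_ge0. Qed.

Let abs_bounds (x : R) : - `|x| <= x <= `|x|.
Proof. by rewrite -ler_norml. Qed.

(* A limit that does not exist has the default value 0, which satisfies the
   bound too. *)
Let limit_at_0_ge : ((- l)%:E <= limit_at_0 f)%E.
Proof.
rewrite /limit_at_0.
have [cv|dv] := pselect (cvg ((f t)%:E @[t --> 0^'+])); last first.
  by rewrite (dvgP dv) lee_fin oppr_le0.
apply: lime_ge => //; near=> t.
have t0 : 0 < t by [].
have t1 : t <= 1 by near: t; exact: nbhs_right_le.
rewrite lee_fin; have := minorant1 t0 t1; rewrite /l.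
have /andP[] := abs_bounds (f 1); have /andP[] := abs_bounds slope1.
have := normr_ge0 slope2; nra.
Unshelve. all: by end_near. Qed.

Let slope_at_infty_ge : ((- l)%:E <= slope_at_infty f)%E.
Proof.
rewrite /slope_at_infty.
have [cv|dv] := pselect (cvg ((f t / t)%:E @[t --> +oo])); last first.
  by rewrite (dvgP dv) lee_fin oppr_le0.
apply: lime_ge => //; near=> t.
have t1 : 1 <= t by near: t; exact: nbhs_pinfty_ge.
have t0 : 0 < t by lra.
rewrite lee_fin ler_pdivlMr //; have := minorant2 t1; rewrite /l.
have /andP[] := abs_bounds (f 1); have /andP[] := abs_bounds slope2.
have := normr_ge0 slope1; nra.
Unshelve. all: by end_near. Qed.

Let D := `[0%R, 1%R]%classic : set R.

(** The perspective of an affine function u |-> a + s (u - 1) is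
    a (1 - t) + s (2 t - 1), which is bounded on the unit interval; the affine
    minorants of f give the bound inside, and bound the limits at the end
    points. *)
Lemma perspective_bounded_below : exists2 l : R, 0 <= l &
  forall t, D t -> ((- l)%:E <= perspective f t (1 - t))%E.
Proof.
exists l => // t; rewrite /D /= in_itv /= => /andP[t0 t1].
rewrite /perspective subr_eq0; case: eqP => [<-|/eqP t1']; 
  first by rewrite mule1; exact: slope_at_infty_ge.
case: eqP => [->|/eqP t0']; 
  first by rewrite subr0 mule1; exact: limit_at_0_ge.
have tp : 0 < t by rewrite lt_def t0'.
have tq : 0 < 1 - t by rewrite subr_gt0 lt_def t1'.
have u0 : 0 < t / (1 - t) by rewrite divr_gt0.
rewrite lee_fin.
have E s : (1 - t) * (f 1 + s * (t / (1 - t) - 1)) = (1 - t) * f 1 + s * (2 * t - 1).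
  by field; rewrite gt_eqF.
have /andP[] := abs_bounds (f 1); have /andP[] := abs_bounds slope1.
have /andP[] := abs_bounds slope2.
have [u1|/ltW u1] := leP (t / (1 - t)) 1.
  have := ler_wpM2l (ltW tq) (minorant1 u0 u1); rewrite E /l; nra.
have := ler_wpM2l (ltW tq) (minorant2 u1); rewrite E /l; nra.
Qed.

(** The sublevel sets of a convex function are intervals. *)
Lemma measurable_operator_convex : measurable_fun (`]0, +oo[%classic : set R) f.
Proof.
move=> mP; apply: (measurability _ (RGenInftyO.measurableE R)) => //.
move=> /= _ [_ [r ->] <-]; apply: is_interval_measurable => x y /=.
rewrite !in_itv /= !andbT => -[x0 fx] [y0 fy] z /andP[xz zy].
rewrite !in_itv /= andbT; split; first exact: (lt_le_trans x0 xz).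
have [xy|xy] := eqVneq x y; first by rewrite (_ : z = x) //; lra.
have d0 : 0 < y - x by rewrite subr_gt0 lt_def eq_sym xy (le_trans xz).
pose t := (y - z) / (y - x).
have t01 : 0 <= t <= 1.
  apply/andP; split; first by rewrite divr_ge0 ?(ltW d0) ?subr_ge0.
  by rewrite /t ler_pdivrMr // mul1r lerD2l lerN2.
have -> : z = t * x + (1 - t) * y by rewrite /t; field; rewrite gt_eqF.
apply: (le_lt_trans (operator_convex_convex x0 y0 t01)).
have /andP[t0 t1] := t01.
have [t00|t00] := eqVneq t 0; first by rewrite t00 mul0r add0r subr0 mul1r.
have tp : 0 < t by rewrite lt_def t00.
nra.
Qed.

(** At the end points the perspective is defined by limits, and measurability
    there is that of a function on a singleton. *)
Lemma measurable_perspective : measurable_fun D (fun t => perspective f t (1 - t)).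
Proof.
have DE : D = [set 0] `|` (`]0, 1[%classic `|` [set 1]).
  rewrite /D setUA setU1itv ?bnd_simp // (@setUitv1 _ _ (BLeft 0) 1 true) ?bnd_simp //.
have m01 : measurable (`]0%R, 1%R[%classic : set R) by exact: measurable_itv.
rewrite DE; apply/measurable_funU => //; first exact: measurableU.
split; first exact: measurable_fun_set1.
apply/measurable_funU => //; split; last exact: measurable_fun_set1.
pose h t := (1 - t) * f (t / (1 - t)).
apply: (@eq_measurable_fun _ _ _ _ _ (EFin \o h)).
  move=> t /set_mem; rewrite /= in_itv /= => /andP[t0 t1].
  by rewrite /perspective subr_eq0 eq_sym (lt_eqF t1) (gt_eqF t0).
apply/measurable_EFinP; apply: measurable_funM.
  by apply: measurable_funB.
apply: (measurable_comp _ _ measurable_operator_convex).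
- exact: measurable_itv.
- move=> _ [t + <-]; rewrite /= !in_itv /= andbT => /andP[t0 t1].
  by rewrite divr_gt0 // subr_gt0.
apply: open_continuous_measurable_fun; first exact: interval_open.
move=> t /set_mem; rewrite /= in_itv /= => /andP[t0 t1].
apply: cvgM; first exact: cvg_id.
apply: cvgV; first by rewrite subr_eq0 gt_eqF.
by apply: cvgB; [exact: cvg_cst|exact: cvg_id].
Qed.

End OperatorConvexFunctions.

(** * The maximal divergence *)

Section PredualOperations.
Context (R : realType).
Implicit Types H K : hilbertType R.

Lemma predual_posD H (N : set (H -> H)) phi psi : von_neumann_algebra N ->
  predual_pos N phi -> predual_pos N psi -> predual_pos N (phi + psi).
Proof.
move=> vN [[phi0 lphi cphi] pphi] [[psi0 lpsi cpsi] ppsi].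
split; last by move=> X NX pX; apply: addr_ge0; [exact: pphi|exact: ppsi].
have E X : (phi + psi) X = phi X + psi X by [].
split=> [X NX|a X Y NX NY|X0 NX0 e e0].
- by rewrite E phi0 // psi0 // addr0.
- by rewrite !E lphi // lpsi // addrACA -mulrDr.
have e2 : 0 < e / 2 by rewrite divr_gt0.
have [k1 [xi1 [eta1 [d1 [s1 d10 h1]]]]] := cphi X0 NX0 _ e2.
have [k2 [xi2 [eta2 [d2 [s2 d20 h2]]]]] := cpsi X0 NX0 _ e2.
have [/real_gt0_EC[r1 r10 r1E] /real_gt0_EC[r2 r20 r2E]] := (d10, d20).
pose join (u1 : 'I_k1 -> nat -> H) (u2 : 'I_k2 -> nat -> H) (i : 'I_(k1 + k2)) :=
  match fintype.split i with inl j => u1 j | inr j => u2 j end.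
exists (k1 + k2)%N, (join xi1 xi2), (join eta1 eta2), (Num.min r1 r2)%:C; split.
- by move=> i; rewrite /join; case: fintype.split => j; [exact: s1|exact: s2].
- by rewrite ltcR lt_min r10.
move=> X NX small; rewrite [e in _ < e]splitr.
rewrite [X in `|X| < _](_ : _ = (phi X - phi X0) + (psi X - psi X0)); last first.
  by rewrite !E opprD addrACA.
apply: (le_lt_trans (ler_normD _ _)); apply: ltrD.
- apply: h1 => // i; have := small (lshift k2 i).
  rewrite /join (unsplitK (inl i)) r1E => /lt_le_trans; apply.
  by rewrite lecR ge_min lexx.
- apply: h2 => // i; have := small (rshift k1 i).
  rewrite /join (unsplitK (inr i)) r2E => /lt_le_trans; apply.
  by rewrite lecR ge_min lexx orbT.
Qed.

Lemma predual_posZ H (N : set (H -> H)) phi (a : R) : 0 <= a ->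
  predual_pos N phi -> predual_pos N (fun X => a%:C * phi X).
Proof.
move=> a0 [[phi0 lphi cphi] pphi].
split; last by move=> X NX pX; rewrite mulr_ge0 ?ler0c // pphi.
split=> [X NX|b X Y NX NY|X0 NX0 e e0]; first by rewrite phi0 // mulr0.
  by rewrite lphi // mulrDr mulrCA.
have a1 : 0 < (a + 1)%:C :> R[i] by rewrite ltcR ltr_wpDl.
have [k [xi [eta [d [s d0 h]]]]] := cphi X0 NX0 _ (divr_gt0 e0 a1).
exists k, xi, eta, d; split=> // X NX small.
have := h X NX small; rewrite ltr_pdivlMr // => lt.
rewrite -mulrBr normrM ger0_norm ?ler0c // mulrC.
apply: le_lt_trans lt; rewrite ler_wpM2l // lecR lerDl //.
Qed.

Lemma square_summable_bounded H K (C : H -> K) xi : bounded_op C ->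
  square_summable xi -> square_summable (C \o xi).
Proof.
move=> /bounded_opP[_ [c c0 Cc]]; rewrite /square_summable => sxi.
apply: (@le_lt_trans _ _ (\sum_(n <oo) (c ^+ 2)%:E *
    (complex.Re (inner (xi n) (xi n)))%:E)%E).
  apply: lee_nneseries => [n _ _|n _].
    by rewrite innerxx lee_fin Re_EC sqr_ge0.
  rewrite !innerxx !Re_EC -EFinM lee_fin -exprMn.
  have := Cc (xi n); have := hnorm_ge0 (C (xi n)); rewrite /=; nra.
rewrite nneseriesZl; last by move=> n _; rewrite innerxx lee_fin Re_EC sqr_ge0.
by rewrite lte_mul_pinfty // ?lee_fin ?sqr_ge0.
Qed.

(** The seminorm of X given by the sequences C xi and C eta is the seminorm of
    C^* X C given by xi and eta. *)
Lemma push_predual_pos H K (C : H -> K) omega : bounded_op C ->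
  predual_pos (@bounded_op R H H) omega ->
  predual_pos (@bounded_op R K K) (push C omega).
Proof.
move=> bC [[om0 lom com] pom].
have baC := adjoint_bounded bC.
have bc X : bounded_op X -> bounded_op (adjoint C \o X \o C).
  by move=> bX; apply: bounded_op_comp bC; exact: bounded_op_comp.
have pushE X : bounded_op X -> push C omega X = omega (adjoint C \o X \o C).
  by move=> bX; rewrite /push /restriction patchT // inE.
have lin a X Y : adjoint C \o (a *: X + Y) \o C =
    a *: (adjoint C \o X \o C) + (adjoint C \o Y \o C).
  by apply/funext => h; rewrite /= baC.1.
split; last first.
  move=> X bX pX; rewrite pushE //; apply: pom; first exact: bc.
  by move=> h /=; rewrite adjointPr.
split=> [X nX|a X Y bX bY|X0 bX0 e e0].
- by rewrite /push /restriction patchN // notin_setE.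
- rewrite !pushE //; last exact: bounded_op_linear.
  by rewrite lin lom //; exact: bc.
have [k [xi [eta [d [s d0 h]]]]] := com _ (bc _ bX0) e e0.
exists k, (fun i => C \o xi i), (fun i => C \o eta i), d; split=> //.
  by move=> i; have [? ?] := s i; split; exact: square_summable_bounded.
move=> X bX small; rewrite !pushE //; apply: h; first exact: bc.
move=> i; have := small i; rewrite /sigma_weak_seminorm.
suff -> : (fun n => inner ((X - X0) ((C \o xi i) n)) ((C \o eta i) n) : R[i]^o) =
  (fun n => inner (((adjoint C \o X \o C) - (adjoint C \o X0 \o C)) (xi i n)) (eta i n)
     : R[i]^o) by [].
apply/funext => n /=.
by rewrite -adjointPr // !fctE (linear_funB baC.1).
Qed.

Lemma ext_lb_ext H (N : set (H -> H)) m m' : von_neumann_algebra N ->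
  (forall phi, predual_pos N phi -> m phi = m' phi) -> ext_lb N m' -> ext_lb N m.
Proof.
move=> vN mm [h1 h2 h3 h4 [l h5]]; split.
- by move=> phi pphi; rewrite mm //; exact: h1.
- by move=> a phi a0 pphi; rewrite !mm ?h2 //; exact: predual_posZ.
- by move=> phi psi pphi ppsi; rewrite !mm ?h3 //; exact: predual_posD.
- move=> phi pphi r; rewrite mm // => /(h4 _ pphi)[d d0 h]; exists d => // psi ppsi.
  by rewrite mm //; exact: h.
- by exists l => phi pphi; rewrite mm //; exact: h5.
Qed.

End PredualOperations.

Theorem lemma3p3 (R : realType) (L H : hilbertType R)
    (M : set (L -> L)) (N : set (H -> H)) (f : R -> R)
    (Phi Psi : (L -> L) -> H -> H) (S : ((H -> H) -> R[i]) -> \bar R) :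
  von_neumann_algebra M -> von_neumann_algebra N ->
  operator_convex f ->
  completely_positive M N Phi -> completely_positive M N Psi ->
  is_maximal_divergence M f Phi Psi S ->
  ext_lb (@bounded_op R H H) S /\ affiliated N S /\ belongs_to_ext_lb N S.
Proof.
move=> vM vN cf [NPhi _ _] [NPsi _ _] [K [pi [V [A [B [p]]]]]].
move=> [[rep bV GE cl] [cA pA _ PhiE] _ [_ _ _ [E sE pE]] SE].
have [pmE _] := sE.
have NG x : M x -> N (adjoint V \o pi x \o V).
  by move=> Mx; rewrite -GE //; apply: (vN_add vN); [exact: NPhi|exact: NPsi].
have NA x : M x -> N (adjoint V \o A \o pi x \o V).
  by move=> Mx; rewrite -PhiE //; exact: NPhi.
pose G T := adjoint V \o E T \o V.
have GN T : measurable T -> N (G T).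
  exact: (compressed_projection_mem vM vN rep bV NG cl cA NA pA pmE sE).
have [c c0 povmG] := povm_compression bV pmE GN.
have vB := von_neumann_bounded_op H.
have povmB : povm (@bounded_op R H H) G c.
  have [h1 h2 h3 h4] := povmG; split=> // T mT; have [NT pT] := h1 T mT.
  by split=> //; exact: (vN_bounded vN).
have [l l0 gl] := perspective_bounded_below cf.
have mg := measurable_perspective cf.
have mD : measurable (`[0%R, 1%R]%classic : set R) by exact: measurable_itv.
pose m0 := povm_integral G `[0%R, 1%R]%classic (fun t => perspective f t (1 - t)).
have Sm0 omega : predual_pos (@bounded_op R H H) omega -> S omega = m0 omega.
  move=> pom; rewrite SE // /compress pE; last exact: push_predual_pos.
  apply: eq_integral_measurable => T mT.
  rewrite /scalar_measure /push /restriction patchT // inE.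
  exact: (pm_bounded pmE).
split; [|split].
- apply: (ext_lb_ext vB Sm0).
  exact: (povm_integral_ext_lb vB c0 povmB mD mg l0 gl).
- move=> u [bu uu _] cu omega pom; rewrite /compress !Sm0 //; last exact: push_predual_pos.
  apply: eq_integral_measurable => T mT.
  have NT := GN T mT.
  rewrite /push /restriction patchT; last by rewrite inE; exact: (vN_bounded vN).
  suff -> : adjoint u \o G T \o u = G T by [].
  by rewrite -compA -(cu.2 _ NT) compA uu.
- exists m0; first exact: (povm_integral_ext_lb vN c0 povmG mD mg l0 gl).
  move=> omega pom; rewrite Sm0 //; apply: eq_integral_measurable => T mT.
  by rewrite /restriction patchT // inE; exact: GN.
Qed.
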